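(* The functions $U_1,\dots,U_n$ (as multiplication operators) commute with each other, the operators $\mathcal D_1,\dots,\mathcal D_n$ commute with each other, and $[\mathcal D_d,U_k]=\delta_{d,k}$ for all $1\le d,k\le n$. Together, the families $\{U_k\}_{k=1}^n$ and $\{\mathcal D_d\}_{d=1}^n$ generate a subalgebra $\mathcal W_n$ of $(W_n)_{\mathrm{disc}_{G(r,n)}}$ that is isomorphic, as an associative algebra, to the standard rank-$n$ Weyl algebra. Moreover all the denominators occurring in the operators $\mathcal D_I$, namely $r\,x_i^{r-1}\prod_{j\in I,\,j\ne i}(x_j^r-x_i^r)$ for $i\in I\subseteq\{1,\dots,n\}$, divide $\mathrm{disc}_{G(r,n)}$ in $\mathbb{C}[x_1,\dots,x_n]$.
   Context: Let $n,r\ge1$ be integers, $\mathbb{N}_n=\{1,\dots,n\}$, $\mu_r$ the group of $r$-th roots of unity in $\mathbb{C}$, and $G(r,n)=\mu_r^n\rtimes S_n$ acting on $\mathbb{C}^n$ by $(\zeta;\sigma)\cdot x=(\zeta_1x_{\sigma^{-1}(1)},\dots,\zeta_nx_{\sigma^{-1}(n)})$. Let $E_h(x)=e_h(x_1^r,\dots,x_n^r)$ with $e_h$ the $h$-th elementary symmetric function, $\widetilde E_h=\frac{(n-h)!}{n!}E_h$, and for a partition $\lambda$ with multiplicities $m_h$ let $\widetilde E_\lambda=\prod_h\widetilde E_h^{\,m_h}$. Let $\Delta_i=\frac{1}{r\,x_i^{r-1}}\partial_{x_i}$; for nonempty $I\subseteq\mathbb{N}_n$ let $\mathcal D_I=\sum_{i\in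 I}\frac{1}{\prod_{j\in I,\,j\ne i}(x_j^r-x_i^r)}\Delta_i$; and for $1\le d\le n$ let $\mathcal D_d=d!\sum_{|I|=d}\mathcal D_I$. For $1\le k\le n$, $U_k=\sum_{\lambda\vdash k}(-1)^{l(\lambda)-1}\frac{(l(\lambda)-1)!}{\prod_{h=1}^km_h!}\widetilde E_\lambda$ ($l(\lambda)$ = number of parts), which is the unique $G(r,n)$-invariant polynomial, homogeneous of degree $rk$, with $\mathcal D_dU_k=\delta_{d,k}$ for all $1\le d\le n$. The discriminant of $G(r,n)$ is $\mathrm{disc}_{G(r,n)}(x)=\prod_{i=1}^nx_i^{r-1}\prod_{1\le i<j\le n}(x_i^r-x_j^r)$. $W_n$ denotes the usual Weyl algebra generated by $x_1,\dots,x_n,\partial_{x_1},\dots,\partial_{x_n}$ over $\mathbb{C}$, and $(W_n)_{\mathrm{disc}_{G(r,n)}}=W_n[\mathrm{disc}_{G(r,n)}^{-1}]$ its localization at the discriminant. The standard rank-$n$ Weyl algebra is the associative $\mathbb{C}$-algebra with generators $p_1,\dots,p_n,q_1,\dots,q_n$ and relations $[p_d,q_k]=\delta_{d,k}$, $[p_d,p_{d'}]=[q_k,q_{k'}]=0$. *)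

(* Defs.v *)
From HB Require Import structures.
From mathcomp Require Import all_boot all_order all_algebra.
From mathcomp Require Import boolp classical_sets reals.
From mathcomp Require Import complex.
From mathcomp Require monalg.

Set Implicit Arguments.
Unset Strict Implicit.
Unset Printing Implicit Defensive.

Import GRing.Theory.
Local Open Scope ring_scope.
Local Open Scope classical_set_scope.

(* [monalg] is imported in this module only: its notations for multivariate
   polynomials clash with those of [mpoly]. *)
Module FreeAlgebra.
Import monalg.

Section FreeAlgebra.
Variables (F : comNzRingType) (I : choiceType).

Definition free_alg : Type := {malg F[{fmonom I}]}.

HB.instance Definition _ := GRing.Lalgebra.on free_alg.

Lemma free_alg_scaleAr (k : F) (x y : free_alg) : k *: (x * y) = x * (k *: y).
Proof.
have fC (a : {malg F[{fmonom I}]}) : k *: a = a * k%:A.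
  have k1 : k%:A = << k *g (@mone _) >> :> {malg F[{fmonom I}]}.
    by apply/malgP => j; rewrite mcoeffZ mcoeff1 mcoeffU mulr_natr eq_sym.
  rewrite [a]monalgE scaler_sumr mulr_suml; apply: eq_bigr => m _.
  rewrite k1 malgM_def fgmulUU mulm1.
  by apply/malgP => j; rewrite mcoeffZ !mcoeffU mulrnAr mulrC.
by rewrite (fC (x * y)) -mulrA -(fC y).
Qed.

HB.instance Definition _ :=
  GRing.Lalgebra_isAlgebra.Build F free_alg free_alg_scaleAr.

Definition free_gen (i : I) : free_alg := << fmu i >>.

End FreeAlgebra.
End FreeAlgebra.
HB.export FreeAlgebra.
Export FreeAlgebra.

From mathcomp Require Import mpoly.
Local Open Scope complex_scope.
Local Open Scope quotient_scope.

Section Quotient.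
Variables (F : comNzRingType) (A : algType F).

Definition two_sided_ideal (J : set A) : Prop :=
  [/\ J 0, forall x y, J x -> J y -> J (x + y),
      forall a x, J x -> J (a * x) & forall a x, J x -> J (x * a)].

Definition ideal_gen (S : set A) : set A :=
  [set x | forall J, two_sided_ideal J -> S `<=` J -> J x].

Lemma ideal_gen_ideal S : two_sided_ideal (ideal_gen S).
Proof.
split=> [J [] //|x y Jx Jy J JI SJ|a x Jx J JI SJ|a x Jx J JI SJ].
- by case: (JI) => _ + _ _; apply; [exact: Jx|exact: Jy].
- by case: (JI) => _ _ + _; apply; exact: Jx.
- by case: (JI) => _ _ _; apply; exact: Jx.
Qed.

Variable S : set A.

Definition in_ideal (x : A) : bool := `[< ideal_gen S x >].

Lemma in_ideal_zmod : zmod_closed (in_ideal : {pred A}).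
Proof.
have [I0 ID IM _] := ideal_gen_ideal S.
split=> [|x y /asboolP Ix /asboolP Iy]; apply/asboolP => //.
by apply: ID => //; rewrite -mulN1r; apply: IM.
Qed.

HB.instance Definition _ := GRing.isZmodClosed.Build A in_ideal in_ideal_zmod.

Definition ideal_pred : zmodClosed A := GRing.ZmodClosed.clone A in_ideal _.

(* The quotient of A by the two-sided ideal generated by S. It is given a ring
   and an F-module structure, which are compatible ([quot_scaleAl] and
   [quot_scaleAr]), but not the structure [algType], because that one also
   requires 1 != 0. *)
Definition quot_alg : Type := Quotient.quot ideal_pred.

HB.instance Definition _ := GRing.Zmodule.on quot_alg.
HB.instance Definition _ := Choice.on quot_alg.

Definition quot_map (x : A) : quot_alg := \pi_(Quotient.quot ideal_pred) x.

Lemma quot_mapP x y : quot_map x = quot_map y <-> ideal_gen S (x - y).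
Proof.
split=> [/eqP|Ixy]; first by rewrite -Quotient.idealrBE => /asboolP.
by apply/eqP; rewrite -Quotient.idealrBE; apply/asboolP.
Qed.

Definition quot_repr (x : quot_alg) : A := repr x.

Lemma quot_reprK : cancel quot_repr quot_map.
Proof. exact: reprK. Qed.

Lemma quot_map_zmod : zmod_morphism quot_map.
Proof. exact: (raddfB \pi_(Quotient.quot ideal_pred)). Qed.

HB.instance Definition _ :=
  GRing.isZmodMorphism.Build A quot_alg quot_map quot_map_zmod.

Definition quot_one : quot_alg := quot_map 1.
Definition quot_mul (x y : quot_alg) : quot_alg :=
  quot_map (quot_repr x * quot_repr y).
Definition quot_scale (k : F) (x : quot_alg) : quot_alg :=
  quot_map (k *: quot_repr x).

Lemma quot_mapM x y : quot_map (x * y) = quot_mul (quot_map x) (quot_map y).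
Proof.
have [_ ID IM IMr] := ideal_gen_ideal S.
have E z : ideal_gen S (z - quot_repr (quot_map z)).
  by apply/quot_mapP; rewrite quot_reprK.
apply/quot_mapP; set x' := quot_repr _; set y' := quot_repr _.
have -> : x * y - x' * y' = (x - x') * y + x' * (y - y').
  by rewrite mulrBl mulrBr addrA subrK.
by apply: ID; [apply: IMr; exact: E|apply: IM; exact: E].
Qed.

Lemma quot_mapZ k x : quot_map (k *: x) = quot_scale k (quot_map x).
Proof.
have [_ _ IM _] := ideal_gen_ideal S.
apply/quot_mapP; rewrite -scalerBr -mulr_algl; apply: IM.
by apply/quot_mapP; rewrite quot_reprK.
Qed.

Lemma quot_ind (P : quot_alg -> Prop) : (forall x, P (quot_map x)) -> forall x, P x.
Proof. by move=> Pm x; rewrite -(quot_reprK x). Qed.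

Lemma quot_mulA : associative quot_mul.
Proof.
by elim/quot_ind=> x; elim/quot_ind=> y; elim/quot_ind=> z;
  rewrite -!quot_mapM mulrA.
Qed.
Lemma quot_mul1 : left_id quot_one quot_mul.
Proof. by elim/quot_ind=> x; rewrite -quot_mapM mul1r. Qed.
Lemma quot_mul1r : right_id quot_one quot_mul.
Proof. by elim/quot_ind=> x; rewrite -quot_mapM mulr1. Qed.
Lemma quot_mulDl : left_distributive quot_mul +%R.
Proof.
by elim/quot_ind=> x; elim/quot_ind=> y; elim/quot_ind=> z;
  rewrite -raddfD -!quot_mapM mulrDl raddfD.
Qed.
Lemma quot_mulDr : right_distributive quot_mul +%R.
Proof.
by elim/quot_ind=> x; elim/quot_ind=> y; elim/quot_ind=> z;
  rewrite -raddfD -!quot_mapM mulrDr raddfD.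
Qed.

HB.instance Definition _ := GRing.Zmodule_isPzRing.Build quot_alg
  quot_mulA quot_mul1 quot_mul1r quot_mulDl quot_mulDr.

Lemma quot_scaleA a b x : quot_scale a (quot_scale b x) = quot_scale (a * b) x.
Proof. by elim/quot_ind: x => x; rewrite -!quot_mapZ scalerA. Qed.
Lemma quot_scale1 : left_id 1 quot_scale.
Proof. by elim/quot_ind=> x; rewrite -quot_mapZ scale1r. Qed.
Lemma quot_scaleDr : right_distributive quot_scale +%R.
Proof.
by move=> a; elim/quot_ind=> x; elim/quot_ind=> y;
  rewrite -raddfD -!quot_mapZ scalerDr raddfD.
Qed.
Lemma quot_scaleDl x : {morph quot_scale^~ x : a b / a + b}.
Proof.
by elim/quot_ind: x => x a b; rewrite -!quot_mapZ scalerDl raddfD.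
Qed.

HB.instance Definition _ := GRing.Zmodule_isLmodule.Build F quot_alg
  quot_scaleA quot_scale1 quot_scaleDr quot_scaleDl.

Lemma quot_scaleAl (a : F) (x y : quot_alg) : a *: (x * y) = a *: x * y.
Proof.
elim/quot_ind: x => x; elim/quot_ind: y => y.
rewrite -[_ * _]quot_mapM -[LHS]quot_mapZ -[a *: _]quot_mapZ.
by rewrite -[RHS]quot_mapM scalerAl.
Qed.

Lemma quot_scaleAr (a : F) (x y : quot_alg) : a *: (x * y) = x * (a *: y).
Proof.
elim/quot_ind: x => x; elim/quot_ind: y => y.
rewrite -[_ * _]quot_mapM -[LHS]quot_mapZ -[a *: _]quot_mapZ.
by rewrite -[RHS]quot_mapM scalerAr.
Qed.

Lemma quot_map_monoid : monoid_morphism quot_map.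
Proof. by split=> // x y; exact: quot_mapM. Qed.

HB.instance Definition _ :=
  GRing.isMonoidMorphism.Build A quot_alg quot_map quot_map_monoid.

Lemma quot_map_scalable : scalable quot_map.
Proof. by move=> k x; exact: quot_mapZ. Qed.

HB.instance Definition _ :=
  GRing.isScalable.Build F A quot_alg *:%R quot_map quot_map_scalable.

End Quotient.

Definition presented (F : comNzRingType) (I : choiceType)
  (rels : set (free_alg F I)) : Type := quot_alg rels.

Section Presented.
Variables (F : comNzRingType) (I : choiceType) (rels : set (free_alg F I)).

HB.instance Definition _ := GRing.PzRing.on (presented rels).
HB.instance Definition _ := GRing.Lmodule.on (presented rels).

Definition presented_gen (i : I) : presented rels :=
  quot_map rels (free_gen F i).

Definition subalg_gen (G : set (presented rels)) : set (presented rels) :=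
  [set x | forall S : {pred (presented rels)},
             GRing.mulr_closed S -> GRing.submod_closed S ->
             (forall y, G y -> y \in S) -> x \in S].

(* The two-sided inverse of x; 0 if x is not invertible. *)
Definition presented_inv (x : presented rels) : presented rels :=
  xget 0 [set y | x * y = 1 /\ y * x = 1].

(* The subalgebra A of [presented rels] is isomorphic to
   [presented rels']. *)
Definition isom_subalg (A : set (presented rels)) (I' : choiceType)
    (rels' : set (free_alg F I')) : Prop :=
  exists f : {rmorphism presented rels' -> presented rels},
    [/\ scalable f, injective f & range f = A].

End Presented.

Section Weyl.
Variables (F : comNzRingType) (n : nat).

Let fp (i : 'I_n) : free_alg F ('I_n + 'I_n)%type := free_gen F (inl i).
Let fq (i : 'I_n) : free_alg F ('I_n + 'I_n)%type := free_gen F (inr i).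

Definition weyl_rels : set (free_alg F ('I_n + 'I_n)%type) :=
  [set z | exists d k, [\/ z = fp d * fq k - fq k * fp d - (d == k)%:R,
                           z = fp d * fp k - fp k * fp d
                         | z = fq d * fq k - fq k * fq d]].

(* The rank-n Weyl algebra, with generators p_d = weyl_p d, q_k = weyl_q k.
   As the algebra of polynomial differential operators, q_k is multiplication
   by the coordinate x_k and p_d is the partial derivative with respect
   to x_d. *)
Definition weyl : Type := presented weyl_rels.

HB.instance Definition _ := GRing.PzRing.on weyl.
HB.instance Definition _ := GRing.Lmodule.on weyl.

Definition weyl_p (d : 'I_n) : weyl := presented_gen weyl_rels (inl d).
Definition weyl_q (k : 'I_n) : weyl := presented_gen weyl_rels (inr k).

Definition weyl_poly (f : {mpoly F[n]}) : weyl :=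
  \sum_(m <- msupp f) f@_m *: \prod_(i < n) weyl_q i ^+ m i.

End Weyl.

(* The localization A[a^-1]: the algebra obtained from A by freely adjoining a
   two-sided inverse of a. It is presented by one generator for each element
   of A, subject to the relations that hold in A, and one more generator [None]
   inverse to a. *)
Section Localization.
Variables (F : comNzRingType) (I : choiceType) (rels : set (free_alg F I)).
Let A : choiceType := presented rels.
Variable a : presented rels.

Let g (x : presented rels) : free_alg F (option A) := free_gen F (Some x).
Let s : free_alg F (option A) := free_gen F None.

Definition loc_rels : set (free_alg F (option A)) :=
  [set z | [\/ exists x y : presented rels, z = g (x + y) - g x - g y,
               exists k (x : presented rels), z = g (k *: x) - k *: g x,
               exists x y : presented rels, z = g (x * y) - g x * g y
             | [\/ z = g 1 - 1, z = s * g a - 1 | z = g a * s - 1]]].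

Definition localization : Type := presented loc_rels.

HB.instance Definition _ := GRing.PzRing.on localization.
HB.instance Definition _ := GRing.Lmodule.on localization.

Definition loc_map (x : presented rels) : localization :=
  presented_gen loc_rels (Some x).

End Localization.

Definition mpoly_dvd (F : comNzRingType) (n : nat) (p q : {mpoly F[n]}) : Prop :=
  exists s, q = s * p.

Section Operators.
Variables (R : realType) (n r : nat).
Local Notation C := R[i].

Definition E (h : nat) : {mpoly C[n]} :=
  mesym n C h \mPo [tuple 'X_i ^+ r | i < n].

Definition Etilde (h : nat) : {mpoly C[n]} :=
  ((n - h)`!%:R / n`!%:R : C) *: E h.

(* A partition of k is given by its multiplicities: m h is the number of parts
   equal to h.+1. Such a number is at most k. *)
Definition is_part (k : nat) (m : {ffun 'I_k -> 'I_k.+1}) : bool :=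
  (\sum_(h < k) h.+1 * m h == k)%N.

Definition part_length (k : nat) (m : {ffun 'I_k -> 'I_k.+1}) : nat :=
  (\sum_(h < k) m h)%N.

Definition U (k : nat) : {mpoly C[n]} :=
  \sum_(m : {ffun 'I_k -> 'I_k.+1} | is_part m)
    ((-1) ^+ (part_length m - 1) * (part_length m - 1)`!%:R
       / (\prod_(h < k) (m h)`!)%N%:R : C)
    *: \prod_(h < k) Etilde h.+1 ^+ m h.

Definition disc : {mpoly C[n]} :=
  (\prod_(i < n) 'X_i ^+ (r - 1))
  * \prod_(i < n) \prod_(j < n | (i < j)%N) ('X_i ^+ r - 'X_j ^+ r).

Definition weyl_disc : Type := localization (weyl_poly disc).

HB.instance Definition _ := GRing.PzRing.on weyl_disc.
HB.instance Definition _ := GRing.Lmodule.on weyl_disc.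

Definition mult (f : {mpoly C[n]}) : weyl_disc :=
  loc_map (weyl_poly disc) (weyl_poly f).

Definition partial (i : 'I_n) : weyl_disc :=
  loc_map (weyl_poly disc) (weyl_p C i).

Definition Delta (i : 'I_n) : weyl_disc :=
  presented_inv (mult (r%:R * 'X_i ^+ (r - 1))) * partial i.

Definition D_set (I : {set 'I_n}) : weyl_disc :=
  \sum_(i in I)
    presented_inv (mult (\prod_(j in I | j != i) ('X_j ^+ r - 'X_i ^+ r))) * Delta i.

Definition D (d : nat) : weyl_disc :=
  (d`!%:R : C) *: \sum_(I : {set 'I_n} | #|I| == d) D_set I.

Definition denominator (I : {set 'I_n}) (i : 'I_n) : {mpoly C[n]} :=
  r%:R * 'X_i ^+ (r - 1) * \prod_(j in I | j != i) ('X_j ^+ r - 'X_i ^+ r).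

Definition Weyl_gens : set weyl_disc :=
  [set x | exists2 k, (1 <= k <= n)%N & x = mult (U k) \/ x = D k].

End Operators.

(* Main.v *)
Require Import Defs.
From HB Require Import structures.
From mathcomp Require Import all_boot all_order all_algebra.
From mathcomp Require Import boolp classical_sets functions reals complex mpoly.
From mathcomp Require Import ring zify.
From mathcomp Require Import fintype finset.
From mathcomp Require finmap monalg.

(* Write y_i = x_i^r, so that Delta_i is d/dy_i. Lagrange interpolation at the
   points -y_i, for i in I, shows that D_I maps prod_j (z + y_j) to
   prod_(j notin I) (z + y_j); taking coefficients and summing over |I| = d, the
   vector field D_d maps Etilde_h to Etilde_(h-d). The polynomials U_k are the
   coefficients of log (sum_h Etilde_h t^h), which D_d therefore shifts by t^d:
   D_d U_k = delta_dk. The matrix of the fields D_d is then inverse to the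
   Jacobian matrix of the U_k, so that a vector field which kills all the U_k is
   zero; this applies to the commutators [D_d, D_e].
   The resulting map from the rank-n Weyl algebra is injective: commutators with
   the generators act on normally ordered expressions as partial derivatives, so
   a nonzero element of the kernel could be lowered to a nonzero constant, while
   the localization is nontrivial because it acts on the field of rational
   functions. All computations with denominators are done with polynomials, by
   means of the cofactors of the denominators in the discriminant. *)

Set Implicit Arguments.
Unset Strict Implicit.
Unset Printing Implicit Defensive.

Import GRing.Theory Num.Theory.
Local Open Scope ring_scope.
Local Open Scope complex_scope.

(** * Algebras presented by generators and relations *)

Module FreeAlgebraTheory.
Import monalg finmap.

Section FreeAlgebraTheory.
Variables (F : comNzRingType) (I : choiceType).

(** Elements are linear combinations of words, and words grow by letters added on the left, so
    closure under left multiplication by generators suffices. *)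
Lemma free_alg_ind (P : free_alg F I -> Prop) :
  P 1 -> (forall x y, P x -> P y -> P (x + y)) -> (forall k x, P x -> P (k *: x)) ->
  (forall i x, P x -> P (free_gen F i * x)) -> forall x, P x.
Proof.
move=> P1 PD PZ PM x; rewrite [x]monalgE.
apply: (big_ind P) => [|//|m _]; first by rewrite -(scale0r 1); apply: PZ.
have -> : << mcoeff m x *g m >> = mcoeff m x *: << m >> :> {malg F[{fmonom I}]}.
  by apply/malgP => j; rewrite mcoeffZ !mcoeffU mulr_natr.
apply: PZ; rewrite -[m]fmK; elim: (m : seq I) => [|i s IH]; first by rewrite -fmoneE.
have -> : << FMonom (i :: s) >> = << fmu i >> * << FMonom s >> :> {malg F[{fmonom I}]}.
  by rewrite malgM_def fgmulUU mulr1 fmuE /mmul /= fmmulE.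
exact: PM.
Qed.

Variables (B : pzRingType) (c : {rmorphism F -> B}) (g : I -> B).
Hypothesis cC : forall k i, c k * g i = g i * c k.

Let word (m : {fmonom I}) : B := \prod_(i <- (m : seq I)) g i.
Let ev (x : free_alg F I) : B := \sum_(m <- msupp x) c (mcoeff m x) * word m.

Let evE (d : {fset {fmonom I}}) x : (msupp x `<=` d)%fset ->
  ev x = \sum_(m <- d) c (mcoeff m x) * word m.
Proof.
move=> xd; rewrite /ev; apply: (big_fset_incl _ xd) => m _ mx.
by rewrite mcoeff_outdom // rmorph0 mul0r.
Qed.

Let ev_zmod : zmod_morphism ev.
Proof.
move=> x y; pose d := (msupp x `|` msupp y)%fset.
rewrite !(@evE d) ?msuppB_le ?fsubsetUl ?fsubsetUr // -sumrB.
by apply: eq_bigr => m _; rewrite mcoeffB rmorphB mulrBl.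
Qed.

Let evZ k x : ev (k *: x) = c k * ev x.
Proof.
rewrite (@evE (msupp x)) ?msuppZ_le // mulr_sumr; apply: eq_bigr => m _.
by rewrite mcoeffZ rmorphM mulrA.
Qed.

(** Universal property of the free algebra. The scalars enter [B] through [c], so that [B] can be
    any ring, such as a presented ring or a ring of endomorphisms. *)
Lemma free_alg_eval : exists f : {rmorphism free_alg F I -> B},
  (forall i, f (free_gen F i) = g i) /\ (forall k x, f (k *: x) = c k * f x).
Proof.
have ev1 k m : ev << k *g m >> = c k * word m.
  rewrite (@evE [fset m]%fset) ?msuppU_le // big_seq_fset1 mcoeffU eqxx mulr1n.
  by [].
pose Z := GRing.isZmodMorphism.Build _ _ ev ev_zmod.
pose evA : {additive free_alg F I -> B} := HB.pack ev Z.
have ev_monoid : monoid_morphism ev.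
  split=> [|x y]; first by rewrite ev1 rmorph1 mul1r /word fm1 big_nil.
  have wM m m' : word (mmul m m') = word m * word m' by rewrite /word fmM big_cat.
  have evsum (s : seq {fmonom I}) f : ev (\sum_(m <- s) f m) = \sum_(m <- s) ev (f m).
    exact: (raddf_sum evA).
  rewrite malgM_def /fgmul evsum mulr_suml; apply: eq_bigr => m _.
  rewrite evsum mulr_sumr; apply: eq_bigr => m' _.
  rewrite ev1 rmorphM wM -!mulrA; congr (_ * _); rewrite !mulrA; congr (_ * _).
  by apply: commr_prod => i _; apply: cC.
pose M := GRing.isMonoidMorphism.Build _ _ ev ev_monoid.
pose f : {rmorphism free_alg F I -> B} := HB.pack ev Z M.
exists f; split=> [i|]; last exact: evZ.
by rewrite /= ev1 rmorph1 mul1r /word fmU big_seq1.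
Qed.
End FreeAlgebraTheory.
End FreeAlgebraTheory.

Export FreeAlgebraTheory.

Section PresentedTheory.
Variables (F : comNzRingType) (I : choiceType) (rels : set (free_alg F I)).
Local Notation A := (presented rels).

Definition presented_map (x : free_alg F I) : A := quot_map rels x.
Local Notation "\pi x" := (presented_map x) (at level 10, x at level 9).

Lemma presented_mapB x y : \pi (x - y) = \pi x - \pi y.
Proof. exact: (raddfB (quot_map rels)). Qed.

Lemma presented_mapD x y : \pi (x + y) = \pi x + \pi y.
Proof. exact: (raddfD (quot_map rels)). Qed.

Lemma presented_mapM x y : \pi (x * y) = \pi x * \pi y.
Proof. exact: quot_mapM. Qed.

Lemma presented_map1 : \pi 1 = 1.
Proof. by []. Qed.

Lemma presented_map_nat k : \pi k%:R = k%:R.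
Proof. exact: (rmorph_nat (quot_map rels)). Qed.

Lemma presented_mapZ k x : \pi (k *: x) = k *: \pi x.
Proof. exact: quot_mapZ. Qed.

Lemma presented_map_rel x y : rels (x - y) -> \pi x = \pi y.
Proof. by move=> rz; apply/quot_mapP => J _; apply. Qed.

(** This lemma and the next four match the shapes in which [weyl_rels] and [loc_rels] write their
    relations. *)
Lemma presented_map_rel_comm x y z : rels (x * y - y * x - z) ->
  \pi x * \pi y - \pi y * \pi x = \pi z.
Proof. by move/presented_map_rel; rewrite presented_mapB !presented_mapM. Qed.

Lemma presented_map_relC x y : rels (x * y - y * x) -> \pi x * \pi y = \pi y * \pi x.
Proof. by move/presented_map_rel; rewrite !presented_mapM. Qed.

Lemma presented_map_relD x y z : rels (x - y - z) -> \pi x = \pi y + \pi z.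
Proof.
by move/presented_map_rel; rewrite presented_mapB => /eqP; rewrite subr_eq addrC => /eqP.
Qed.

Lemma presented_map_relM x y z : rels (x - y * z) -> \pi x = \pi y * \pi z.
Proof. by move/presented_map_rel; rewrite presented_mapM. Qed.

Lemma presented_map_relV x y : rels (x * y - 1) -> \pi x * \pi y = 1.
Proof. by move/presented_map_rel; rewrite presented_mapM. Qed.

Lemma presented_ind (P : A -> Prop) :
  P 1 -> (forall x y, P x -> P y -> P (x + y)) -> (forall k x, P x -> P (k *: x)) ->
  (forall i x, P x -> P (presented_gen rels i * x)) -> forall x, P x.
Proof.
move=> P1 PD PZ PM; elim/quot_ind; elim/free_alg_ind => [//|x y Px Py|k x Px|i x Px].
- by rewrite -/(\pi _) presented_mapD; apply: PD.
- by rewrite -/(\pi _) presented_mapZ; apply: PZ.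
- by rewrite -/(\pi _) presented_mapM; apply: PM.
Qed.

(** The kernel of [f] is a two-sided ideal containing the relations, hence contains the ideal they
    generate; so the value of [f] at a representative does not depend on the choice. *)
Lemma presented_lift (B : pzRingType) (f : {rmorphism free_alg F I -> B}) :
  (forall z, rels z -> f z = 0) ->
  exists f' : {rmorphism A -> B}, forall x, f' (\pi x) = f x.
Proof.
move=> f0; pose f' (x : A) : B := f (quot_repr x).
have f'E x : f' (\pi x) = f x.
  apply/eqP; rewrite -subr_eq0 -rmorphB; apply/eqP.
  have : ideal_gen rels (quot_repr (quot_map rels x) - x).
    by apply/quot_mapP; rewrite quot_reprK.
  move=> /(_ (fun z => f z = 0)); apply; last exact: f0.
  split=> [|y z /= y0 z0|y z /= z0|y z /= z0].
  - exact: rmorph0.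
  - by rewrite rmorphD y0 z0 addr0.
  - by rewrite rmorphM z0 mulr0.
  - by rewrite rmorphM z0 mul0r.
have f'B : zmod_morphism f'.
  elim/quot_ind=> x; elim/quot_ind=> y.
  by rewrite -!/(\pi _) -presented_mapB !f'E rmorphB.
have f'M : monoid_morphism f'.
  split; first by rewrite -presented_map1 f'E rmorph1.
  elim/quot_ind=> x; elim/quot_ind=> y.
  by rewrite -!/(\pi _) -presented_mapM !f'E rmorphM.
pose Z := GRing.isZmodMorphism.Build _ _ f' f'B.
pose M := GRing.isMonoidMorphism.Build _ _ f' f'M.
pose g : {rmorphism A -> B} := HB.pack f' Z M.
by exists g.
Qed.

(** The scalars as central elements: a presented algebra, which may be zero, is handled as a ring
    together with this morphism. *)
Definition pscal (k : F) : A := k *: (1 : A).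

Lemma pscalE k (x : A) : k *: x = pscal k * x.
Proof. by rewrite /pscal -[RHS]quot_scaleAl mul1r. Qed.

Lemma pscalC k (x : A) : pscal k * x = x * pscal k.
Proof. by rewrite -pscalE /pscal -[RHS]quot_scaleAr mulr1. Qed.

Lemma pscal_zmod : zmod_morphism pscal.
Proof. by move=> k l; rewrite /pscal scalerBl. Qed.

Lemma pscal_monoid : monoid_morphism pscal.
Proof.
split=> [|k l]; first exact: scale1r.
by rewrite -pscalE /pscal scalerA.
Qed.

HB.instance Definition _ := GRing.isZmodMorphism.Build F A pscal pscal_zmod.
HB.instance Definition _ := GRing.isMonoidMorphism.Build F A pscal pscal_monoid.

End PresentedTheory.

Arguments pscal {F I} rels k.
Arguments presented_map {F I} rels x.

Lemma presented_lift_gen (F : comNzRingType) (I : choiceType) (rels : set (free_alg F I))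
    (B : pzRingType) (c : {rmorphism F -> B}) (g : I -> B) :
  (forall k i, c k * g i = g i * c k) ->
  (forall f : {rmorphism free_alg F I -> B}, (forall i, f (free_gen F i) = g i) ->
     (forall k x, f (k *: x) = c k * f x) -> forall z, rels z -> f z = 0) ->
  exists f : {rmorphism presented rels -> B},
    (forall i, f (presented_gen rels i) = g i) /\ (forall k x, f (k *: x) = c k * f x).
Proof.
move=> cC frel; have [f [fg fZ]] := free_alg_eval cC.
have [f' f'E] := presented_lift (frel f fg fZ).
exists f'; split=> [i|k]; first by rewrite f'E.
by elim/quot_ind=> x; rewrite -!/(presented_map _ _) -presented_mapZ !f'E.
Qed.

(** * Polynomials evaluated in a noncommutative ring *)

Lemma mderiv_mpolyX (F : nzRingType) (n : nat) (i j : 'I_n) :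
  ('X_j : {mpoly F[n]})^`M(i) = (i == j)%:R.
Proof.
rewrite mderivX mnm1E eq_sym; case: eqP => [->|_]; last by rewrite scale0r.
have -> : (U_(j) - U_(j) = 0 :> 'X_{1..n})%MM.
  by apply/mnmP => k; rewrite mnmBE subnn mnm0E.
by rewrite scale1r mpolyX0.
Qed.

Lemma mpoly_linear_ind (F : nzRingType) (N : nat) (P : {mpoly F[N]} -> Prop) :
  (forall m, P 'X_[m]) -> (forall p q, P p -> P q -> P (p + q)) ->
  (forall k p, P p -> P (k *: p)) -> forall p, P p.
Proof.
move=> PX PD PZ; elim/mpolyind => [|k m p mp k0 Pp].
  by rewrite -(scale0r 'X_[0]); apply: PZ.
by apply: PD => //; apply: PZ.
Qed.

Section OrderedEvaluation.
Variables (F : comNzRingType) (A : pzRingType) (c : {rmorphism F -> A}) (N : nat) (h : 'I_N -> A).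
Implicit Types (p q : {mpoly F[N]}) (m : 'X_{1..N}).

(* The h i need not commute: they are multiplied in increasing order of i. *)
Definition omon m : A := \prod_(i < N) h i ^+ m i.
Definition oeval p : A := \sum_(m <- msupp p) c p@_m * omon m.

Lemma oevalE p (s : seq 'X_{1..N}) : uniq s -> {subset msupp p <= s} ->
  oeval p = \sum_(m <- s) c p@_m * omon m.
Proof.
move=> us ps; rewrite [RHS](bigID (fun m => m \in msupp p)) /= [X in _ + X]big1 ?addr0.
  rewrite -big_filter; apply/perm_big/uniq_perm; rewrite ?filter_uniq ?msupp_uniq //.
  by move=> m; rewrite mem_filter; case: (boolP (m \in msupp p)) => // /ps ->.
by move=> m; rewrite -mcoeff_eq0 => /eqP ->; rewrite rmorph0 mul0r.
Qed.

Lemma oeval_is_zmod_morphism : zmod_morphism oeval.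
Proof.
move=> p q; set s := undup (msupp p ++ msupp q ++ msupp (p - q)).
rewrite !(@oevalE _ s) ?undup_uniq //; try by
  move=> m ms; rewrite mem_undup !mem_cat ms ?orbT.
by rewrite -sumrB; apply: eq_bigr => m _; rewrite mcoeffB rmorphB mulrBl.
Qed.

HB.instance Definition _ :=
  GRing.isZmodMorphism.Build {mpoly F[N]} A oeval oeval_is_zmod_morphism.

Lemma oevalZ k p : oeval (k *: p) = c k * oeval p.
Proof.
rewrite (@oevalE (k *: p) (msupp p)) ?msupp_uniq //; last exact: msuppZ_le.
rewrite mulr_sumr; apply: eq_bigr => m _.
by rewrite mcoeffZ rmorphM mulrA.
Qed.

Lemma oevalXm m : oeval 'X_[m] = omon m.
Proof. by rewrite /oeval msuppX big_seq1 mcoeffX eqxx rmorph1 mul1r. Qed.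

Lemma omon0 : omon 0%MM = 1.
Proof. by rewrite /omon big1 // => i _; rewrite mnm0E. Qed.

Lemma oevalC k : oeval k%:MP = c k.
Proof. by rewrite -[k%:MP]mulr1 mul_mpolyC oevalZ -mpolyX0 oevalXm omon0 mulr1. Qed.

Lemma omonU i : omon U_(i)%MM = h i.
Proof.
rewrite /omon; under eq_bigr do rewrite mnm1E.
have : i \in index_enum 'I_N by rewrite mem_index_enum.
elim: (index_enum _) (index_enum_uniq 'I_N) => // j s IH /= /andP[js us].
rewrite inE big_cons; case: eqP js => [<- is_ _|_ _ si]; last by rewrite expr0 mul1r IH.
rewrite big_seq big1 ?mulr1 // => k ks; case: eqP => // e.
by rewrite e ks in is_.
Qed.

Lemma oevalXU i : oeval 'X_i = h i.
Proof. by rewrite oevalXm omonU. Qed.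

Section Commuting.
Hypothesis hC : forall i j, h i * h j = h j * h i.
Hypothesis cC : forall k x, c k * x = x * c k.

Lemma omonD m1 m2 : omon (m1 + m2)%MM = omon m1 * omon m2.
Proof.
rewrite /omon; elim: (index_enum _) => [|i s IH]; first by rewrite !big_nil mulr1.
rewrite !big_cons IH mnmDE exprD -!mulrA; congr (_ * _); rewrite !mulrA; congr (_ * _).
apply: commr_prod => j _; apply/commr_sym/commrX/commr_sym/commrX; exact: hC.
Qed.

Lemma oevalM p q : oeval (p * q) = oeval p * oeval q.
Proof.
elim/mpoly_linear_ind: p => [m|p1 p2 e1 e2|k p e].
- elim/mpoly_linear_ind: q => [m'|q1 q2 e1 e2|k q e].
  + by rewrite -mpolyXD !oevalXm omonD.

  + by rewrite mulrDr !raddfD /= e1 e2 mulrDr.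
  + by rewrite -scalerAr !oevalZ e !mulrA cC.
- by rewrite mulrDl !raddfD /= e1 e2 mulrDl.
- by rewrite -scalerAl !oevalZ e mulrA.
Qed.

End Commuting.

Section Derivation.
Variables (delta : A -> A) (z : 'I_N -> A).
Hypothesis deltaB : zmod_morphism delta.
Hypothesis deltaM : forall x y, delta (x * y) = delta x * y + x * delta y.
Hypothesis deltac : forall k, delta (c k) = 0.
Hypothesis deltah : forall i, delta (h i) = z i.
Hypothesis zC : forall i x, z i * x = x * z i.

Let delta0 : delta 0 = 0.
Proof. by rewrite -{1}(subrr 0) deltaB subrr. Qed.

Let deltaD x y : delta (x + y) = delta x + delta y.
Proof. by rewrite -{1}[y]opprK -[- y]sub0r !deltaB delta0 sub0r opprK. Qed.

Let delta1 : delta 1 = 0.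
Proof. by rewrite -(rmorph1 c) deltac. Qed.

Let deltaX i k : delta (h i ^+ k) = (h i ^+ k.-1 * z i) *+ k.
Proof.
elim: k => [|k IH]; first by rewrite expr0 delta1.
rewrite exprS deltaM deltah IH zC /= mulrnAr mulrA -exprS mulrS.
by case: k {IH} => // k; rewrite mulr0n mulr0n.
Qed.

(** Leibniz rule: being central, [z i] moves to the end even if the [h i] do not commute. If
    [m i = 0] the subtraction of [U_(i)] is truncated, but the term then has multiplicity 0. *)
Lemma delta_omon m : delta (omon m) = \sum_(i < N) (omon (m - U_(i))%MM * z i) *+ m i.
Proof.
(* In a duplicate-free list the index split off does not recur, so subtracting it leaves the other
   exponents unchanged. *)
have gen s : uniq s -> delta (\prod_(i <- s) h i ^+ m i)
    = \sum_(i <- s) (\prod_(j <- s) h j ^+ (m - U_(i))%MM j * z i) *+ m i.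
  elim: s => [|a s IH /= /andP[as_ us]]; first by rewrite !big_nil delta1.
  rewrite !big_cons deltaM {}IH // deltaX; congr (_ + _).
    rewrite mnmBE mnm1E eqxx subn1 mulrnAl -mulrA zC mulrA.
    congr ((_ * _ * _) *+ _); rewrite big_seq [RHS]big_seq; apply: eq_bigr => j js.
    rewrite mnmBE mnm1E; case: eqP => [e|_]; last by rewrite subn0.
    by rewrite e js in as_.
  rewrite mulr_sumr big_seq [RHS]big_seq; apply: eq_bigr => i si.
  rewrite big_cons mnmBE mnm1E; case: eqP => [e|_].
    by rewrite -e si in as_.
  by rewrite subn0 mulrnAr !mulrA.
exact/gen/index_enum_uniq.
Qed.

(** Used twice: for inner derivations, and as the chain rule for composed polynomials. *)
Lemma delta_oeval p : delta (oeval p) = \sum_i oeval p^`M(i) * z i.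
Proof.
elim/mpoly_linear_ind: p => [m|p q ep eq|k p ep].
- rewrite oevalXm delta_omon; apply: eq_bigr => i _.
  by rewrite mderivX oevalZ oevalXm rmorph_nat mulr_natl mulrnAl.
- rewrite raddfD /= deltaD ep eq -big_split; apply: eq_bigr => i _.
  by rewrite mderivD raddfD mulrDl.
- rewrite oevalZ deltaM deltac mul0r add0r ep mulr_sumr; apply: eq_bigr => i _.
  by rewrite mderivZ oevalZ mulrA.
Qed.

End Derivation.

Lemma oeval_commutator (a : A) (z : 'I_N -> A) :
  (forall k, a * c k = c k * a) -> (forall i, a * h i - h i * a = z i) ->
  (forall i x, z i * x = x * z i) ->
  forall p, a * oeval p - oeval p * a = \sum_i oeval p^`M(i) * z i.
Proof.
move=> ac ah zC p; apply: (@delta_oeval (fun x => a * x - x * a)) => //.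
- by move=> x y; rewrite mulrBr mulrBl !opprB addrACA [RHS]addrAC -!addrA.
- by move=> x y; rewrite mulrBl mulrBr !mulrA addrA subrK.
- by move=> k; rewrite ac subrr.
Qed.

Lemma oeval_commutator1 (a : A) (i : 'I_N) :
  (forall k, a * c k = c k * a) -> (forall j, a * h j - h j * a = (i == j)%:R) ->
  forall p, a * oeval p - oeval p * a = oeval p^`M(i).
Proof.
move=> ac ah p; rewrite (oeval_commutator ac ah) => [|j x]; last by rewrite mulr_natl mulr_natr.
rewrite (bigD1 i) //= eqxx mulr1 big1 ?addr0 // => j ji.
by rewrite eq_sym (negbTE ji) mulr0.
Qed.

End OrderedEvaluation.

(** * The action on rational functions *)

Section QuotientRule.
Variable K : fieldType.

Definition quotient_rule (a b da db : K) : K := (da * b - a * db) / b ^+ 2.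

Variables a b a' b' da db da' db' : K.
Hypotheses (b0 : b != 0) (b'0 : b' != 0).

(** Makes the derivative of a fraction well defined: the second hypothesis is the first one
    differentiated, and the cross-multiplied difference is a combination of the two. *)
Lemma quotient_rule_eq : a * b' = a' * b -> da * b' + a * db' = da' * b + a' * db ->
  quotient_rule a b da db = quotient_rule a' b' da' db'.
Proof.
move=> e de; apply/eqP; rewrite eqr_div ?expf_neq0 //; apply/eqP/subr0_eq.
transitivity (b * b' * ((da * b' + a * db') - (da' * b + a' * db))
    - (db * b' + b * db') * (a * b' - a' * b)); first by ring.
by rewrite de e !subrr !mulr0 subrr.
Qed.

Lemma quotient_ruleB :
  quotient_rule (a * b' - a' * b) (b * b')
    (da * b' + a * db' - (da' * b + a' * db)) (db * b' + b * db')
  = quotient_rule a b da db - quotient_rule a' b' da' db'.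
Proof. by rewrite /quotient_rule; field; rewrite b0 b'0. Qed.

Lemma quotient_ruleM :
  quotient_rule (a * a') (b * b') (da * a' + a * da') (db * b' + b * db')
  = quotient_rule a b da db * (a' / b') + a / b * quotient_rule a' b' da' db'.
Proof. by rewrite /quotient_rule; field; rewrite b0 b'0. Qed.

End QuotientRule.

Section FractionDerivation.
Variables (R : idomainType) (delta : {additive R -> R}).
Hypothesis deltaM : forall a b, delta (a * b) = delta a * b + a * delta b.
Local Notation K := {fraction R}.
Local Notation "x %:F" := (@FracField.tofrac R x).

Lemma fractionP (x : K) : exists ab : R * R, ab.2 != 0 /\ x = ab.1%:F / ab.2%:F.
Proof.
elim/quotW: x => r; exists (val r); split; first exact: denom_ratioP.
have d0 : (val r).2%:F != 0 by rewrite tofrac_eq0 denom_ratioP.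
apply: (mulIf d0); rewrite mulfVK // /FracField.tofrac; unlock.
rewrite -[LHS]FracField.pi_mul /FracField.mulf; apply/eqmodP; rewrite /= FracField.equivfE.
by rewrite !numden_Ratio ?oner_eq0 ?mulr1 ?mulf_neq0 ?denom_ratioP // mulrC.
Qed.

Let frac_rule (a b : R) : K := quotient_rule a%:F b%:F (delta a)%:F (delta b)%:F.

Let frac_rule_eq a b a' b' : b != 0 -> b' != 0 ->
  a%:F / b%:F = a'%:F / b'%:F -> frac_rule a b = frac_rule a' b'.
Proof.
move=> b0 b'0; have [B0 B'0] : b%:F != 0 /\ b'%:F != 0 by rewrite !tofrac_eq0.
move/eqP; rewrite eqr_div // -!tofracM tofrac_eq => /eqP e.
apply: quotient_rule_eq => //; first by rewrite -!tofracM e.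
rewrite -!tofracM -!tofracD.
by rewrite -!deltaM e.
Qed.

(** The quotient rule at a chosen numerator and denominator; by [frac_rule_eq] any other choice
    gives the same value. *)
Definition fraction_der (x : K) : K :=
  let ab := sval (cid (fractionP x)) in frac_rule ab.1 ab.2.

Lemma fraction_derE a b : b != 0 -> fraction_der (a%:F / b%:F) = frac_rule a b.
Proof.
move=> b0; rewrite /fraction_der; case: cid => -[a' b'] /= [b'0 e].
exact/esym/frac_rule_eq.
Qed.

Lemma fraction_der_zmod : zmod_morphism fraction_der.
Proof.
move=> x y; have [[a b] /= [b0 ->]] := fractionP x; have [[a' b'] /= [b'0 ->]] := fractionP y.
have [B0 B'0] : b%:F != 0 /\ b'%:F != 0 by rewrite !tofrac_eq0.
have -> : a%:F / b%:F - a'%:F / b'%:F = (a * b' - a' * b)%:F / (b * b')%:F.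
  by rewrite -mulNr addf_div // mulNr tofracB !tofracM.
rewrite !fraction_derE ?mulf_neq0 // -quotient_ruleB // /frac_rule (raddfB delta) /= !deltaM.
by rewrite !(tofracB, tofracD, tofracM).
Qed.

Lemma fraction_derM x y :
  fraction_der (x * y) = fraction_der x * y + x * fraction_der y.
Proof.
have [[a b] /= [b0 ->]] := fractionP x; have [[a' b'] /= [b'0 ->]] := fractionP y.
have [B0 B'0] : b%:F != 0 /\ b'%:F != 0 by rewrite !tofrac_eq0.
have -> : a%:F / b%:F * (a'%:F / b'%:F) = (a * a')%:F / (b * b')%:F.
  by rewrite !tofracM mulf_div.
rewrite !fraction_derE ?mulf_neq0 // -quotient_ruleM // /frac_rule !deltaM.
by rewrite !(tofracD, tofracM).
Qed.

Lemma fraction_der_tofrac a : fraction_der a%:F = (delta a)%:F.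
Proof.
have d1 : delta 1 = 0.
  by apply: (addIr (delta 1)); rewrite add0r -{3}[1]mulr1 deltaM mulr1 mul1r.
rewrite -[a%:F]divr1 -tofrac1 fraction_derE ?oner_neq0 // /frac_rule /quotient_rule d1.
by rewrite tofrac0 tofrac1 mulr0 subr0 expr1n !mulr1 divr1.
Qed.

End FractionDerivation.

(** Clear the denominator [b] of [x]: on [x * b], an element of [R], the derivations commute.
    Expanding by Leibniz, the mixed terms match, and [b] cancels. *)
Lemma fraction_der_comm (R : idomainType) (d1 d2 : {additive R -> R}) :
  (forall a b, d1 (a * b) = d1 a * b + a * d1 b) ->
  (forall a b, d2 (a * b) = d2 a * b + a * d2 b) ->
  (forall a, d1 (d2 a) = d2 (d1 a)) ->
  forall x, fraction_der d1 (fraction_der d2 x) = fraction_der d2 (fraction_der d1 x).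
Proof.
move=> d1M d2M d12 x; have [[a b] /= [b0 xE]] := fractionP x.
set D1 := fraction_der d1; set D2 := fraction_der d2.
have D1B : zmod_morphism D1 by apply: fraction_der_zmod.
have D2B : zmod_morphism D2 by apply: fraction_der_zmod.
have D10 : D1 0 = 0 by rewrite -{1}(subrr 0) D1B subrr.
have D20 : D2 0 = 0 by rewrite -{1}(subrr 0) D2B subrr.
have D1D u v : D1 (u + v) = D1 u + D1 v.
  by rewrite -{1}[v]opprK -[- v]sub0r !D1B D10 sub0r opprK.
have D2D u v : D2 (u + v) = D2 u + D2 v.
  by rewrite -{1}[v]opprK -[- v]sub0r !D2B D20 sub0r opprK.
have D1M u v : D1 (u * v) = D1 u * v + u * D1 v by apply: fraction_derM.
have D2M u v : D2 (u * v) = D2 u * v + u * D2 v by apply: fraction_derM.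
have B0 : @FracField.tofrac R b != 0 by rewrite tofrac_eq0.
have tof c : D1 (D2 (@FracField.tofrac R c)) = D2 (D1 (@FracField.tofrac R c)).
  by rewrite /D1 /D2 !fraction_der_tofrac // d12.
clearbody D1 D2.
have : D1 (D2 (x * @FracField.tofrac R b)) = D2 (D1 (x * @FracField.tofrac R b)).
  by rewrite xE mulfVK // tof.
rewrite D2M D1D !D1M D2D !D2M tof => e.
apply: (mulIf B0); apply: (addIr (D2 x * D1 (FracField.tofrac b))).
apply: (addIr (D1 x * D2 (FracField.tofrac b) + x * D2 (D1 (FracField.tofrac b)))).
by rewrite e -!addrA; congr (_ + _); rewrite [RHS]addrCA.
Qed.

(** * The ring of additive endomorphisms of a group *)

Section AdditiveEndomorphisms.
Variable V : zmodType.

Definition is_additive (f : V -> V) : bool := `[< zmod_morphism f >].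

Lemma is_additive_zmod_closed : zmod_closed (is_additive : {pred V -> V}).
Proof.
split=> [|f g /asboolP fB /asboolP gB]; apply/asboolP => x y.
  by rewrite subr0.
have fgE (z : V) : (f - g) z = f z - g z by [].
rewrite !fgE fB gB !opprB -!addrA; congr (_ + _).
by rewrite addrCA [RHS]addrCA [- f y + _]addrC.
Qed.
HB.instance Definition _ :=
  GRing.isZmodClosed.Build (V -> V) is_additive is_additive_zmod_closed.

Record additive_end : Type := AdditiveEnd { end_fun : V -> V; _ : is_additive end_fun }.
HB.instance Definition _ := [isSub for end_fun].
HB.instance Definition _ := [Choice of additive_end by <:].
HB.instance Definition _ := [SubChoice_isSubZmodule of additive_end by <:].

Implicit Types f g h : additive_end.

Lemma additive_endB f x y : end_fun f (x - y) = end_fun f x - end_fun f y.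
Proof. by case: f => f /= /asboolP. Qed.

Lemma additive_endD f x y : end_fun f (x + y) = end_fun f x + end_fun f y.
Proof.
have f0 : end_fun f 0 = 0 by rewrite -{1}(subrr 0) additive_endB subrr.
by rewrite -{1}[y]opprK -[- y]sub0r !additive_endB f0 sub0r opprK.
Qed.

Lemma additive_endP f g : end_fun f =1 end_fun g -> f = g.
Proof. by move=> fg; apply/val_inj/funext. Qed.

Lemma end_one_subproof : is_additive idfun.
Proof. by apply/asboolP. Qed.
Definition end_one := AdditiveEnd end_one_subproof.

Lemma end_mul_subproof f g : is_additive (end_fun f \o end_fun g).
Proof. by apply/asboolP => x y; rewrite /= !additive_endB. Qed.
Definition end_mul f g := AdditiveEnd (end_mul_subproof f g).

Let end_mulA : associative end_mul. Proof. by move=> f g h; apply: additive_endP. Qed.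
Let end_mul1l : left_id end_one end_mul. Proof. by move=> f; apply: additive_endP. Qed.
Let end_mul1r : right_id end_one end_mul. Proof. by move=> f; apply: additive_endP. Qed.
Let end_mulDl : left_distributive end_mul +%R.
Proof. by move=> f g h; apply: additive_endP. Qed.
Let end_mulDr : right_distributive end_mul +%R.
Proof.
move=> f g h; apply: additive_endP => x; exact: additive_endD.
Qed.

HB.instance Definition _ := GRing.Zmodule_isPzRing.Build additive_end
  end_mulA end_mul1l end_mul1r end_mulDl end_mulDr.

End AdditiveEndomorphisms.

Section MultiplicationEndomorphisms.
Variable K : pzRingType.

Lemma mul_end_subproof (x : K) : is_additive ( *%R x).
Proof. by apply/asboolP => y z; rewrite mulrBr. Qed.
Definition mul_end (x : K) : additive_end K := AdditiveEnd (mul_end_subproof x).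

Lemma mul_end_zmod : zmod_morphism mul_end.
Proof. by move=> x y; apply: additive_endP => z; apply: mulrBl. Qed.

Lemma mul_end_monoid : monoid_morphism mul_end.
Proof.
split=> [|x y]; apply: additive_endP => z; first exact: mul1r.
by rewrite /= mulrA.
Qed.

HB.instance Definition _ :=
  GRing.isZmodMorphism.Build K (additive_end K) mul_end mul_end_zmod.
HB.instance Definition _ :=
  GRing.isMonoidMorphism.Build K (additive_end K) mul_end mul_end_monoid.

End MultiplicationEndomorphisms.

(** * The Weyl algebra and its localizations *)

Section WeylTheory.
Variables (F : comNzRingType) (n : nat).
Local Notation W := (weyl F n).
Local Notation rels := (@weyl_rels F n).
Implicit Types (f g : {mpoly F[n]}).

Lemma weyl_pq d k : weyl_p F d * weyl_q F k - weyl_q F k * weyl_p F d = (d == k)%:R :> W.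
Proof.
rewrite -[RHS](presented_map_nat rels).
by apply: presented_map_rel_comm; exists d, k; constructor 1.
Qed.

Lemma weyl_pC d k : weyl_p F d * weyl_p F k = weyl_p F k * weyl_p F d :> W.
Proof. by apply: presented_map_relC; exists d, k; constructor 2. Qed.

Lemma weyl_qC d k : weyl_q F d * weyl_q F k = weyl_q F k * weyl_q F d :> W.
Proof. by apply: presented_map_relC; exists d, k; constructor 3. Qed.

(** Universal property of the Weyl algebra. It yields both the action on rational functions and the
    map to the operators [D d] and the functions [U k]. *)
Lemma weyl_lift (B : pzRingType) (c : {rmorphism F -> B}) (P Q : 'I_n -> B) :
  (forall k i, c k * P i = P i * c k) -> (forall k i, c k * Q i = Q i * c k) ->
  (forall d k, P d * Q k - Q k * P d = (d == k)%:R) ->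
  (forall d k, P d * P k = P k * P d) -> (forall d k, Q d * Q k = Q k * Q d) ->
  exists f : {rmorphism W -> B}, [/\ forall i, f (weyl_p F i) = P i,
    forall i, f (weyl_q F i) = Q i & forall k x, f (k *: x) = c k * f x].
Proof.
move=> cP cQ PQ PP QQ; pose g (i : 'I_n + 'I_n) := match i with inl d => P d | inr k => Q k end.
have [|f fg _ z|f [fg fZ]] := @presented_lift_gen F _ rels B c g.
- by move=> k [] i /=.
- have fC x y : f (x * y - y * x) = f x * f y - f y * f x by rewrite rmorphB !rmorphM.
  move=> [d [k []]] ->; last 2 first.
  + by rewrite fC (fg (inl d)) (fg (inl k)) /= PP subrr.
  + by rewrite fC (fg (inr d)) (fg (inr k)) /= QQ subrr.
  rewrite (rmorphB f (_ - _)) fC (fg (inl d)) (fg (inr k)) /= PQ.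
  by rewrite (rmorph_nat f) subrr.
by exists f; split=> // i; rewrite fg.
Qed.

Lemma weyl_polyE f : weyl_poly f = oeval (pscal rels) (fun i : 'I_n => weyl_q F i) f.
Proof. by apply: eq_bigr => m _; rewrite [LHS]pscalE. Qed.

Lemma weyl_poly_zmod : zmod_morphism (@weyl_poly F n).
Proof. by move=> f g; rewrite !weyl_polyE raddfB. Qed.

Lemma weyl_poly_monoid : monoid_morphism (@weyl_poly F n).
Proof.
split=> [|f g]; first by rewrite weyl_polyE -mpolyC1 oevalC rmorph1.
rewrite !weyl_polyE; apply: oevalM; [exact: weyl_qC|exact: pscalC].
Qed.

HB.instance Definition _ :=
  GRing.isZmodMorphism.Build {mpoly F[n]} W (@weyl_poly F n) weyl_poly_zmod.
HB.instance Definition _ :=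
  GRing.isMonoidMorphism.Build {mpoly F[n]} W (@weyl_poly F n) weyl_poly_monoid.

Lemma weyl_polyZ k f : weyl_poly (k *: f) = k *: weyl_poly f.
Proof. by rewrite !weyl_polyE oevalZ [RHS]pscalE. Qed.

Lemma weyl_polyX (i : 'I_n) : weyl_poly ('X_i : {mpoly F[n]}) = weyl_q F i.
Proof. by rewrite weyl_polyE oevalXU. Qed.

Lemma weyl_p_poly (i : 'I_n) f :
  weyl_p F i * weyl_poly f - weyl_poly f * weyl_p F i = weyl_poly f^`M(i).
Proof.
rewrite !weyl_polyE; apply: oeval_commutator1; last exact: weyl_pq.
by move=> k; rewrite pscalC.
Qed.

End WeylTheory.

(** * The adjoined inverse and the universal property of the localization *)

Section LocalizationTheory.
Variables (F : comNzRingType) (I : choiceType) (rels : set (free_alg F I)).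
Variable a : presented rels.
Local Notation L := (localization a).

Definition loc_inv : L := presented_gen (loc_rels a) None.

Let loc_mapD x y : loc_map a (x + y) = loc_map a x + loc_map a y.
Proof. by apply: presented_map_relD; constructor 1; exists x, y. Qed.

Lemma loc_map_zmod : zmod_morphism (loc_map a).
Proof. by move=> x y; apply/eqP; rewrite eq_sym subr_eq -loc_mapD subrK. Qed.

Lemma loc_map_monoid : monoid_morphism (loc_map a).
Proof.
split=> [|x y]; first by apply: presented_map_rel; constructor 4; constructor 1.
by apply: presented_map_relM; constructor 3; exists x, y.
Qed.

HB.instance Definition _ :=
  GRing.isZmodMorphism.Build (presented rels) L (loc_map a) loc_map_zmod.
HB.instance Definition _ :=
  GRing.isMonoidMorphism.Build (presented rels) L (loc_map a) loc_map_monoid.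

Lemma loc_invl : loc_inv * loc_map a a = 1.
Proof. by apply: presented_map_relV; constructor 4; constructor 2. Qed.

Lemma loc_invr : loc_map a a * loc_inv = 1.
Proof. by apply: presented_map_relV; constructor 4; constructor 3. Qed.

(** The value of the adjoined generator is [t]. The scalars commute with the values of [phi] because
    [c k] is the image of the central element [pscal rels k]. *)
Lemma loc_lift (B : pzRingType) (c : {rmorphism F -> B})
    (phi : {rmorphism presented rels -> B}) (t : B) :
  (forall k x, phi (k *: x) = c k * phi x) -> (forall k, c k * t = t * c k) ->
  t * phi a = 1 -> phi a * t = 1 ->
  exists f : {rmorphism L -> B}, forall x, f (loc_map a x) = phi x.
Proof.
move=> phiZ ct tl tr; pose g i := if i is Some x then phi x else t.
have cphi k : c k = phi (pscal rels k) by rewrite /pscal phiZ rmorph1 mulr1.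
have [|f fg fZ z|f [fg fZ]] := @presented_lift_gen F _ (loc_rels a) B c g.
- by move=> k [x|] //=; rewrite cphi -!rmorphM pscalC.
- have fB x y : f (x - y) = f x - f y by apply: rmorphB.
  have fM i j : f (free_gen F i * free_gen F j) = g i * g j by rewrite rmorphM !fg.
  case=> [[x [y ->]]|[k [x ->]]|[x [y ->]]|[] ->].
  + by rewrite (fB (_ - _)) fB !fg /= rmorphD addrAC addrK subrr.
  + by rewrite fB fZ !fg /= phiZ subrr.
  + by rewrite fB fM fg /= rmorphM subrr.
  + by rewrite fB fg /= !rmorph1 subrr.
  + by rewrite fB fM rmorph1 /= tl subrr.
  + by rewrite fB fM rmorph1 /= tr subrr.
by exists f => x; exact: fg.
Qed.

End LocalizationTheory.

(** * Nontriviality of the localized Weyl algebra *)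

Section Nontrivial.
Variables (F : idomainType) (n : nat) (a : {mpoly F[n]}).
Hypothesis a0 : a != 0.
Local Notation K := {fraction {mpoly F[n]}}.
Local Notation "x %:F" := (@FracField.tofrac {mpoly F[n]} x).

Let mderivMl i (f g : {mpoly F[n]}) : (f * g)^`M(i) = f^`M(i) * g + f * g^`M(i).
Proof. exact: mderivM. Qed.

Let der (i : 'I_n) : K -> K := fraction_der (mderiv i).

Let der_additive i : is_additive (der i).
Proof. apply/asboolP/fraction_der_zmod; exact: mderivMl. Qed.

Let P i : additive_end K := AdditiveEnd (der_additive i).
Let Q (i : 'I_n) : additive_end K := mul_end ('X_i)%:F.
Let c : {rmorphism F -> additive_end K} := @mul_end K \o @FracField.tofrac _ \o @mpolyC n F.

Let mul_endC (x y : K) : mul_end x * mul_end y = mul_end y * mul_end x.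
Proof. by rewrite -!rmorphM mulrC. Qed.

Let derM i (x y : K) : der i (x * y) = der i x * y + x * der i y.
Proof. by apply: fraction_derM => f g; apply: mderivMl. Qed.

Let der_tofrac i f : der i f%:F = (f^`M(i))%:F.
Proof. by apply: fraction_der_tofrac => g h; apply: mderivMl. Qed.

(** The Weyl algebra acts on the fraction field by derivations and multiplications. There [a] acts
    invertibly, so the action extends to the localization. *)
Lemma weyl_localization_nontrivial : (1 : localization (weyl_poly a)) <> 0.
Proof.
have [|||||rho [rhoP rhoQ rhoZ]] := @weyl_lift F n _ c P Q.
- move=> k i; apply: additive_endP => x /=.
  by rewrite derM der_tofrac mderivC tofrac0 mul0r add0r.
- by move=> k i; apply: mul_endC.
- move=> d k; apply: additive_endP => x.
  transitivity (der d (('X_k)%:F * x) - ('X_k)%:F * der d x); first by [].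
  rewrite derM addrK der_tofrac mderiv_mpolyX.
  by case: (d == k); rewrite ?tofrac1 ?tofrac0 ?mul1r ?mul0r.
- move=> d k; apply: additive_endP => x.
  by apply: fraction_der_comm => [f g|f g|f]; [apply: mderivMl|apply: mderivMl|apply: mderiv_comm].
- by move=> d k; apply: mul_endC.
have rho_poly f : rho (weyl_poly f) = mul_end f%:F.
  elim/mpoly_linear_ind: f => [m|f g ef eg|k f ef].
  - rewrite mpolyXE_id !rmorph_prod; apply: eq_bigr => i _.
    by rewrite !rmorphXn; congr (_ ^+ _); rewrite -[RHS]rhoQ -weyl_polyX.
  - rewrite tofracD; transitivity (mul_end f%:F + mul_end g%:F).
      rewrite -ef -eg; transitivity (rho (weyl_poly f + weyl_poly g)).
        congr (rho _); exact: (rmorphD (@weyl_poly F n)).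
      exact: (rmorphD rho).
    exact/esym/(rmorphD (@mul_end K)).
  - rewrite weyl_polyZ rhoZ ef -mul_mpolyC tofracM; exact/esym/(rmorphM (@mul_end K)).
have aF0 : a%:F != 0 by rewrite tofrac_eq0.
have [| | |f _] := @loc_lift _ _ _ (weyl_poly a) _ c rho (mul_end a%:F^-1) rhoZ.
- by move=> k; apply: mul_endC.
- by rewrite rho_poly -rmorphM mulVf ?rmorph1.
- by rewrite rho_poly -rmorphM mulfV ?rmorph1.
(* If 1 were 0, the identity endomorphism would send the rational function 1 to 0. *)
move/(congr1 f); rewrite rmorph1 rmorph0 => /(congr1 (fun u => end_fun u 1)) /eqP.
by rewrite oner_eq0.
Qed.

End Nontrivial.

(** * Normally ordered expressions *)

Section NormalOrdering.
Variables (F : numFieldType) (A : pzRingType) (c : {rmorphism F -> A}) (n : nat).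
Variables (P Q : 'I_n -> A).
Hypothesis cP : forall k i, c k * P i = P i * c k.
Hypothesis cQ : forall k i, c k * Q i = Q i * c k.
Hypothesis PQ : forall d k, P d * Q k - Q k * P d = (d == k)%:R.
Hypothesis PP : forall d k, P d * P k = P k * P d.
Hypothesis QQ : forall d k, Q d * Q k = Q k * Q d.
Implicit Types p : {mpoly F[n + n]}.

(** The first [n] variables stand for the [Q i] and the last [n] for the [P i], so the increasing
    order of [omon] puts every [Q] to the left of every [P]. *)
Definition normal_gen (i : 'I_(n + n)) : A :=
  match split i with inl j => Q j | inr j => P j end.

Definition normal_form : {mpoly F[n + n]} -> A := oeval c normal_gen.

Let genl i : normal_gen (lshift n i) = Q i.
Proof. by rewrite /normal_gen (unsplitK (inl i)). Qed.

Let genr i : normal_gen (rshift n i) = P i.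
Proof. by rewrite /normal_gen (unsplitK (inr i)). Qed.

Lemma normal_form_commP p i :
  P i * normal_form p - normal_form p * P i = normal_form p^`M(lshift n i).
Proof.
apply: oeval_commutator1 => [k|j]; first by rewrite cP.
case: (split_ordP j) => k ->; first by rewrite genl PQ (inj_eq (@lshift_inj _ _)).
by rewrite genr PP subrr eq_lrshift.
Qed.

Lemma normal_form_commQ p i :
  normal_form p * Q i - Q i * normal_form p = normal_form p^`M(rshift n i).
Proof.
(* The commutator of [- Q i] with [P i] is 1, so [- Q i] acts as the derivative in the variable of
   [P i]. *)
rewrite -[RHS](@oeval_commutator1 _ _ _ _ _ (- Q i)) => [|k|j].
- by rewrite mulNr mulrN opprK addrC.
- by rewrite mulNr mulrN cQ.
case: (split_ordP j) => k ->.
  by rewrite genl mulNr mulrN opprK QQ addNr eq_rlshift.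
by rewrite genr mulNr mulrN opprK addrC PQ eq_sym (inj_eq (@rshift_inj _ _)).
Qed.

Let ml (m : 'X_{1..n + n}) : 'X_{1..n} := [multinom m (lshift n i) | i < n].
Let mr (m : 'X_{1..n + n}) : 'X_{1..n} := [multinom m (rshift n i) | i < n].

Let omon_normal m : omon normal_gen m = omon Q (ml m) * omon P (mr m).
Proof.
rewrite /omon big_split_ord; congr (_ * _); apply: eq_bigr => i _.
  by rewrite genl mnmE.
by rewrite genr mnmE.
Qed.

Lemma normal_form_Xl p i : normal_form ('X_(lshift n i) * p) = Q i * normal_form p.
Proof.
rewrite /normal_form; elim/mpoly_linear_ind: p => [m|p q ep eq|k p ep].
- rewrite -mpolyXD !oevalXm !omon_normal mulrA -(omonU Q i) -omonD //.
  congr (omon Q _ * omon P _); apply/mnmP => j; rewrite !mnmE ?(inj_eq (@lshift_inj _ _)) //.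
  by rewrite eq_lrshift.
- by rewrite mulrDr !raddfD /= ep eq mulrDr.
- by rewrite -scalerAr !oevalZ ep !mulrA cQ.
Qed.

(** On the right a factor [P i] needs no reordering, just as [Q i] needs none on the left. *)
Lemma normal_form_Xr p i : normal_form ('X_(rshift n i) * p) = normal_form p * P i.
Proof.
rewrite /normal_form; elim/mpoly_linear_ind: p => [m|p q ep eq|k p ep].
- rewrite mulrC -mpolyXD !oevalXm !omon_normal -mulrA -(omonU P i) -omonD //.
  congr (omon Q _ * omon P _); apply/mnmP => j; rewrite !mnmE ?(inj_eq (@rshift_inj _ _)) //.
  by rewrite eq_rlshift addn0.
- by rewrite mulrDr !raddfD /= ep eq mulrDl.
- by rewrite -scalerAr !oevalZ ep !mulrA.
Qed.

(** Moving [P i] from the left end to the right end costs the commutator, which is a derivative. *)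
Lemma normal_form_mulP p i :
  P i * normal_form p = normal_form ('X_(rshift n i) * p + p^`M(lshift n i)).
Proof.
transitivity (normal_form ('X_(rshift n i) * p) + normal_form p^`M(lshift n i)).
  by rewrite -normal_form_commP normal_form_Xr addrC subrK.
exact/esym/raddfD.
Qed.

(* Commutators lower the degree until only a constant is left. *)
Lemma normal_form_inj p : (1 : A) <> 0 -> normal_form p = 0 -> p = 0.
Proof.
move=> A1.
suff gen d : forall p, (forall m, (d <= mdeg m)%N -> p@_m = 0) -> normal_form p = 0 -> p = 0.
  apply: (gen (msize p)) => m; rewrite msizeE => pm; apply/memN_msupp_eq0.
  by apply: contraL pm => mp; rewrite -ltnNge; apply: msize_mdeg_lt.
elim: d => [|d IH] {}p pd p0.
  by apply/mpolyP => m; rewrite mcoeff0 pd.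
(* Each derivative has smaller degree and is still killed by [normal_form], being a commutator. *)
have dp i : p^`M(i) = 0.
  apply: IH => [m dm|].
    by rewrite mcoeff_deriv pd ?mul0rn // mdegD mdeg1 addn1 ltnS.
  case: (split_ordP i) => j ->.
    by rewrite -normal_form_commP p0 mulr0 mul0r subrr.
  by rewrite -normal_form_commQ p0 mulr0 mul0r subrr.
have pC : p = (p@_0)%:MP.
  apply/mpolyP => m; rewrite mcoeffC; case: (m =P 0%MM) => [->|/eqP m0]; first by rewrite mulr1.
  have [i mi] : exists i, (0 < m i)%N.
    apply/existsP; apply: contraR m0 => /existsPn m0; apply/eqP/mnmP => i.
    by rewrite mnm0E; apply/eqP; rewrite -leqn0 leqNgt.
  (* This coefficient of the derivative is [p@_m] times the nonzero integer [m i]; characteristic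
     zero gives [p@_m = 0]. *)
  rewrite mulr0; have := congr1 (mcoeff (m - U_(i))%MM) (dp i).
  rewrite mcoeff_deriv mcoeff0 submK => [/eqP|].
    by rewrite mulrn_eq0 => /eqP.
  by apply/mnm_lepP => j; rewrite mnm1E; case: eqP => // <-.
move: p0; rewrite pC /normal_form oevalC => c0.
suff -> : p@_0 = 0 by rewrite mpolyC0.
apply/eqP/negPn/negP => k0; apply: A1.
by rewrite -(rmorph1 c) -(mulVf k0) rmorphM c0 mulr0.
Qed.

End NormalOrdering.

(** * Injectivity of morphisms from the Weyl algebra to a nonzero ring *)

Section WeylSimple.
Variables (F : numFieldType) (n : nat) (B : pzRingType).
Variables (c : {rmorphism F -> B}) (f : {rmorphism weyl F n -> B}).
Hypothesis fZ : forall k x, f (k *: x) = c k * f x.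

Let pW (i : 'I_n) : weyl F n := weyl_p F i.
Let qW (i : 'I_n) : weyl F n := weyl_q F i.
Let cW := pscal (@weyl_rels F n).

(** The normally ordered expressions contain 1 and are stable under left multiplication by each
    generator. *)
Lemma weyl_normal_form (x : weyl F n) : exists p, x = normal_form cW pW qW p.
Proof.
elim/presented_ind: x => [|x y [p ->] [q ->]|k x [p ->]|[i|i] x [p ->]].
- by exists 1; rewrite /normal_form -mpolyC1 oevalC rmorph1.
- by exists (p + q); rewrite /normal_form raddfD.
- by exists (k *: p); rewrite /normal_form oevalZ [LHS]pscalE.
- eexists; apply: (@normal_form_mulP _ _ cW _ pW qW).
  + by move=> k j; apply: pscalC.
  + exact: weyl_pq.
  + exact: weyl_pC.
eexists; apply/esym; apply: (@normal_form_Xl _ _ cW _ pW qW).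
- by move=> k j; apply: pscalC.
- exact: weyl_qC.
Qed.

(** The images of the generators satisfy the same relations in [B], so [normal_form_inj] applies in
    [B] to the image of a normal form. *)
Lemma weyl_morphism_inj : (1 : B) <> 0 -> injective f.
Proof.
move=> B1; pose fp i := f (pW i); pose fq i := f (qW i).
have fnf p : f (normal_form cW pW qW p) = normal_form c fp fq p.
  rewrite /normal_form; elim/mpoly_linear_ind: p => [m|p q ep eq|k p ep].
  - rewrite !oevalXm; transitivity (\prod_(i < n + n) f (normal_gen pW qW i ^+ m i)).
      exact: (rmorph_prod f).
    apply: eq_bigr => i _; transitivity (f (normal_gen pW qW i) ^+ m i).
      exact: (rmorphXn f).
    by congr (_ ^+ _); rewrite /normal_gen; case: split.
  - transitivity (f (oeval cW (normal_gen pW qW) p + oeval cW (normal_gen pW qW) q)).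
      congr (f _); exact: raddfD.
    rewrite (raddfD f) [X in X + _]ep [X in _ + X]eq; exact/esym/raddfD.
  - by rewrite !oevalZ -pscalE fZ ep.
have cf k x : c k * f x = f x * c k.
  have ck : c k = f (cW k) by rewrite /cW /pscal fZ rmorph1 mulr1.
  by rewrite ck -!(rmorphM f) pscalC.
have f0 z : f z = 0 -> z = 0.
  have [p ->] := weyl_normal_form z; rewrite fnf => p0.
  suff -> : p = 0 by exact: raddf0.
  apply: (normal_form_inj _ _ _ _ _ B1 p0) => [k i|k i|d k|d k|d k]; rewrite ?cf //.
  - rewrite -!(rmorphM f) -(rmorphB f) weyl_pq; exact: (rmorph_nat f).
  - by rewrite -!(rmorphM f) weyl_pC.
  - by rewrite -!(rmorphM f) weyl_qC.
by move=> x y fxy; apply/subr0_eq/f0; rewrite (rmorphB f) fxy subrr.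
Qed.

End WeylSimple.

(** * The functions E_h and U_k *)

Section Lagrange.
Variables (T : idomainType) (N : finType) (y : N -> T).
Hypothesis y_inj : injective y.

Lemma coef_prod_XaddC (A : {set N}) m :
  (\prod_(j in A) ('X + (y j)%:P))`_m
  = \sum_(J : {set N} | (J \subset A) && (#|A :\: J| == m)) \prod_(j in J) y j.
Proof.
(* Outside [A] the factors are written as [0 + 1], so that the product runs over all of [N] and
   subsets not contained in [A] contribute 0. *)
pose F j : {poly T} := if j \in A then (y j)%:P else 0.
pose G j : {poly T} := if j \in A then 'X else 1.
have -> : \prod_(j in A) ('X + (y j)%:P) = \prod_j (F j + G j).
  rewrite big_mkcond; apply: eq_bigr => j _; rewrite /F /G.
  by case: ifP => _; rewrite ?add0r // addrC.
rewrite bigA_distr coef_sum [RHS]big_mkcond; apply: eq_bigr => J _.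
case: (boolP (J \subset A)) => [JA|/subsetPn[j jJ jA]] /=; last first.
  by rewrite (bigD1 j) //= jJ /F (negbTE jA) mul0r coef0.
have -> : \prod_j (if j \in J then F j else G j)
          = (\prod_(j in J) y j)%:P * 'X ^+ #|A :\: J|.
  rewrite rmorph_prod -prodr_const [X in _ = X * _]big_mkcond.
  rewrite [X in _ = _ * X]big_mkcond -big_split; apply: eq_bigr => j _ /=.
  rewrite in_setD /F /G; case: (boolP (j \in J)) => [jJ|jJ] /=.
    by rewrite (subsetP JA) // mulr1.
  by rewrite mul1r.
by rewrite coefCM coefXn eq_sym; case: eqP; rewrite (mulr1, mulr0).
Qed.

Variables (I : {set N}) (c : N -> T) (D : T).
Hypothesis I_neq0 : I != set0.
Hypothesis cD : forall k, k \in I -> c k * \prod_(j in I | j != k) (y j - y k) = D.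

(** Interpolation of the constant [D]: both sides have degree less than [#|I|] and agree at the
    distinct points [- y k], [k] in [I], where only the term [i = k] survives. *)
Lemma lagrange_sum :
  \sum_(i in I) (c i)%:P * \prod_(j in I :\ i) ('X + (y j)%:P) = D%:P.
Proof.
set L := \sum_(i in I) _; apply/eqP; rewrite -subr_eq0; apply/negPn/negP => nz.
have szL : (size (L - D%:P)%R <= #|I|)%N.
  have I0 : (0 < #|I|)%N by rewrite card_gt0.
  apply: leq_trans (size_polyD _ _) _; rewrite geq_max size_polyN.
  rewrite (leq_trans (size_polyC_leq1 _)) // andbT.
  apply: leq_trans (size_sum _ _ _) _; apply/bigmax_leqP => i iI.
  rewrite mul_polyC (leq_trans (size_scale_leq _ _)) //.
  rewrite -[in X in (X <= _)%N](big_enum _ _ (mem (I :\ i))).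
  under eq_bigr do rewrite -[y _]opprK polyCN.
  by rewrite size_prod_XsubC -cardE (cardsD1 i I) iI.
have /negP[] : ~~ (#|I| < size (L - D%:P)%R)%N by rewrite -leqNgt.
rewrite cardE -(size_map (fun k => - y k)); apply: max_poly_roots => //; last first.
  by rewrite map_inj_uniq ?enum_uniq // => a b /oppr_inj /y_inj.
apply/allP => z /mapP[k]; rewrite mem_enum => kI ->.
rewrite /root hornerD hornerN hornerC subr_eq0 /L horner_sum (bigD1 k) //=.
rewrite [X in _ + X]big1 ?addr0 => [|i /andP[iI ik]]; last first.
  have kIi : k \in I :\ i by rewrite !inE eq_sym ik.
  rewrite hornerM horner_prod (bigD1 k) //=.
  by rewrite hornerD hornerX !hornerC addNr mul0r mulr0.
rewrite hornerM hornerC horner_prod -(cD kI); apply/eqP; congr (_ * _).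
apply: eq_big => [j|j _]; first by rewrite !inE andbC.
by rewrite hornerD hornerX hornerC addrC.
Qed.

(** Multiply [lagrange_sum] by the factors [X + y j] with [j] outside [I] and take the coefficient
    of degree [#|N| - h]. This leaves subsets of size [h - 1] on the left and [h - #|I|] on the
    right. *)
Lemma lagrange_coef h : (0 < h <= #|N|)%N ->
  \sum_(i in I) c i * \sum_(J : {set N} | (i \notin J) && (#|J|.+1 == h))
     \prod_(j in J) y j
  = D * \sum_(J : {set N} | (J \subset ~: I) && (#|J| + #|I| == h)%N)
     \prod_(j in J) y j.
Proof.
move=> /andP[h0 hN].
have := congr1 (fun p => (p * \prod_(j in ~: I) ('X + (y j)%:P))`_(#|N| - h)) lagrange_sum.
rewrite /= coefCM coef_prod_XaddC mulr_suml coef_sum => e.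
transitivity (D * \sum_(J : {set N} | (J \subset ~: I) && (#|~: I :\: J| == #|N| - h)%N)
     \prod_(j in J) y j); last first.
  congr (_ * _); apply: eq_bigl => J; apply: andb_id2l => JI.
  rewrite cardsD (setIidPr JI); have := subset_leq_card JI; have := cardsC I.
  move: hN; move: #|N| #|J| #|I| #|~: I| => *; lia.
rewrite -e; apply: eq_bigr => i iI; rewrite -mulrA.
have -> : \prod_(j in I :\ i) ('X + (y j)%:P) * \prod_(j in ~: I) ('X + (y j)%:P)
          = \prod_(j in [set~ i]) ('X + (y j)%:P).
  rewrite (bigID (mem I) (fun j => j \in [set~ i])) /=; congr (_ * _); apply: eq_bigl => j.
    by rewrite !inE.
  by rewrite !inE; case: eqP => // ->; rewrite iI.
rewrite coefCM coef_prod_XaddC; congr (_ * _); apply: eq_bigl => J.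
rewrite subsetC sub1set inE; apply: andb_id2l => iJ.
have JI : J \subset [set~ i] by rewrite subsetC sub1set inE.
rewrite cardsD (setIidPr JI); have := subset_leq_card JI; rewrite cardsC1.
move: hN; move: #|N| #|J| => *; lia.
Qed.

End Lagrange.

(** * Divisibility of products of polynomials *)

Section Divisibility.
Variables (F : comNzRingType) (n : nat).
Implicit Types p q : {mpoly F[n]}.

Lemma mpoly_dvdM p q p' q' : mpoly_dvd p q -> mpoly_dvd p' q' -> mpoly_dvd (p * p') (q * q').
Proof. by move=> [s ->] [s' ->]; exists (s * s'); rewrite mulrACA. Qed.

Lemma mpoly_dvd_refl p : mpoly_dvd p p.
Proof. by exists 1; rewrite mul1r. Qed.

Lemma mpoly_dvd1 p : mpoly_dvd 1 p.
Proof. by exists p; rewrite mulr1. Qed.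

Lemma mpoly_dvd_prod (I : Type) (s : seq I) (P Q : pred I) (f g : I -> {mpoly F[n]}) :
  (forall i, P i -> Q i /\ mpoly_dvd (f i) (g i)) ->
  mpoly_dvd (\prod_(i <- s | P i) f i) (\prod_(i <- s | Q i) g i).
Proof.
move=> PQ; rewrite big_mkcond [X in mpoly_dvd _ X]big_mkcond /=.
apply: (big_ind2 (@mpoly_dvd F n)) => [|p q p' q'|i _].
- exact: mpoly_dvd_refl.
- exact: mpoly_dvdM.
by case: ifP => [/PQ[-> //]|_]; apply: mpoly_dvd1.
Qed.

(** The factors with [j > i] occur, up to sign, in row [i] of the double product; each factor with
    [j < i] occurs in its own row [j]. *)
Lemma mpoly_dvd_prod_pairs (f : 'I_n -> 'I_n -> {mpoly F[n]}) (I : {set 'I_n}) i :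
  (forall j k, f j k = - f k j) ->
  mpoly_dvd (\prod_(j in I | j != i) f j i) (\prod_(j < n) \prod_(k < n | (j < k)%N) f j k).
Proof.
move=> fN; rewrite (bigID (fun j : 'I_n => (i < j)%N)).
rewrite [X in mpoly_dvd _ X](bigD1 i) //; apply: mpoly_dvdM.
  apply: mpoly_dvd_prod => j /andP[_ ij]; split=> //.
  by exists (-1); rewrite mulN1r; exact: fN.
apply: mpoly_dvd_prod => j /andP[/andP[_ ji] ij]; split=> //.
exists (\prod_(k < n | (j < k)%N && (k != i)) f j k).
rewrite (bigD1 i) 1?mulrC // ltn_neqAle.
by rewrite -leqNgt in ij; rewrite ij ji.
Qed.

End Divisibility.

(** * The discriminant and the action of the fields on the invariants [E h] *)

Section Invariants.
Variables (R : realType) (n r : nat).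
Hypothesis hr : (1 <= r)%N.
Local Notation C := R[i].
Local Notation y := (fun j : 'I_n => 'X_j ^+ r : {mpoly C[n]}).

Lemma Xpow_inj : injective y.
Proof.
move=> i j /= /(congr1 (fun p => p@_(U_(i) *+ r)%MM)).
rewrite !mcoeffXn eqxx; case: eqP => [/mnmP/(_ i)|_ /eqP]; last by rewrite oner_eq0.
by rewrite !mulmnE !mnm1E eqxx eq_sym; case: eqP => //= _; move: hr; lia.
Qed.

Lemma mpolyX_neq0 (i : 'I_n) : 'X_i != 0 :> {mpoly C[n]}.
Proof.
apply/eqP => /(congr1 (fun p => p@_(U_(i))%MM))/eqP.
by rewrite mcoeffXU eqxx mcoeff0 oner_eq0.
Qed.

Lemma disc_neq0 : disc R n r != 0.
Proof.
apply: mulf_neq0; apply/prodf_neq0 => i _; first by rewrite expf_neq0 ?mpolyX_neq0.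
apply/prodf_neq0 => j ij; rewrite subr_eq0; apply/eqP => /Xpow_inj e.
by rewrite e ltnn in ij.
Qed.

Lemma denominator_dvd_disc (I : {set 'I_n}) i : i \in I ->
  mpoly_dvd (denominator R r I i) (disc R n r).
Proof.
move=> _; apply: mpoly_dvdM.
  have [s ->] : mpoly_dvd ('X_i ^+ (r - 1)) (\prod_(i < n) 'X_i ^+ (r - 1) : {mpoly C[n]}).
    by exists (\prod_(j < n | j != i) 'X_j ^+ (r - 1)); rewrite (bigD1 i) //= mulrC.
  (* The constant factor [r] of the denominator is invertible in the field of coefficients. *)
  exists ((r%:R^-1)%:MP * s); rewrite mulrACA -mpolyC_nat -mpolyCM mulVf ?mul1r //.
  by rewrite pnatr_eq0 -lt0n.
apply: (@mpoly_dvd_prod_pairs _ _ (fun i j => 'X_i ^+ r - 'X_j ^+ r)) => j k.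
by rewrite opprB.
Qed.

Lemma E_expand h : E R n r h
  = \sum_(A : {set 'I_n} | #|A| == h) \prod_(j in A) 'X_j ^+ r.
Proof.
rewrite /E /mesym raddf_sum; apply: eq_bigr => A _.
rewrite [LHS](rmorph_prod (comp_mpoly [tuple 'X_i ^+ r | i < n])).
by apply: eq_bigr => j _; rewrite [LHS]comp_mpolyXU -tnth_nth tnth_mktuple.
Qed.

Lemma mderiv_Xn (i j : 'I_n) :
  ('X_j ^+ r : {mpoly C[n]})^`M(i) = if i == j then r%:R * 'X_i ^+ (r - 1) else 0.
Proof.
case: r hr => // m _; rewrite subn1 [m.+1.-1]/=.
elim: m => [|m IH]; first by rewrite expr1 expr0 mulr1 mderiv_mpolyX; case: eqP.
rewrite exprS mderivM IH mderiv_mpolyX; case: eqP => [->|_]; last first.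
  by rewrite mulr0 addr0 mul0r.
by rewrite mul1r mulrCA -exprS -[X in X + _]mul1r -mulrDl -[m.+2]add1n natrD.
Qed.

Lemma mderiv_prod_notin (i : 'I_n) (A : {set 'I_n}) : i \notin A ->
  (\prod_(j in A) y j)^`M(i) = 0.
Proof.
move=> iA; apply: (big_ind (fun p : {mpoly C[n]} => p^`M(i) = 0)).
- by rewrite -mpolyC1 mderivC.
- by move=> p q p0 q0; rewrite mderivM p0 q0 mul0r mulr0 addr0.
by move=> j jA; rewrite mderiv_Xn; case: eqP jA => // <-; rewrite (negbTE iA).
Qed.

Lemma mderiv_E h (i : 'I_n) : (E R n r h)^`M(i)
  = r%:R * 'X_i ^+ (r - 1)
    * \sum_(J : {set 'I_n} | (i \notin J) && (#|J|.+1 == h)) \prod_(j in J) 'X_j ^+ r.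
Proof.
rewrite E_expand raddf_sum /= (bigID (fun A : {set 'I_n} => i \in A)) /=.
rewrite [X in _ + X]big1 ?addr0 => [|A /andP[_]]; last exact: mderiv_prod_notin.
rewrite (reindex_onto (fun J => i |: J) (fun A => A :\ i)) /=; last first.
  by move=> A /andP[_ iA]; rewrite setD1K.
rewrite mulr_sumr; apply: eq_big => [J|J /andP[/andP[_ _] /eqP JE]].
  rewrite setU11 andbT cardsU1 andbC; case: (boolP (i \in J)) => iJ /=.
    apply/negbTE; rewrite negb_and; apply/orP; left; apply/eqP.
    by move/(congr1 (fun S : {set 'I_n} => i \in S)); rewrite !inE eqxx iJ.
  by rewrite add1n setU1K ?eqxx.
rewrite (bigD1 i) ?setU11 //= mderivM mderiv_Xn eqxx.
have e : \prod_(j in i |: J | j != i) 'X_j ^+ r = \prod_(j in J) 'X_j ^+ r :> {mpoly C[n]}.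
  by rewrite -[in RHS]JE; apply: eq_bigl => j; rewrite !inE andbC.
rewrite e mderiv_prod_notin ?mulr0 ?addr0 //.
by rewrite -JE !inE eqxx.
Qed.

Variable cof : {set 'I_n} -> 'I_n -> {mpoly C[n]}.
Hypothesis cofE : forall (I : {set 'I_n}) i, i \in I -> disc R n r = cof I i * denominator R r I i.

(** The polynomial coefficient of the [i]-th partial derivative in the discriminant times [D d],
    since [cof I i] over the discriminant is the inverse of [denominator R r I i]. *)
Definition field_coef (d : nat) (i : 'I_n) : {mpoly C[n]} :=
  d`!%:R * \sum_(I : {set 'I_n} | (i \in I) && (#|I| == d)) cof I i.

(** For each [I], [lagrange_coef] leaves the subsets [J] of size [h - d] disjoint from [I]. Summed
    over [I], each [J] is counted once per [d]-subset of its complement, whence the binomial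
    coefficient. *)
Lemma field_coef_E d h : (0 < d)%N -> (0 < h <= n)%N ->
  \sum_i field_coef d i * (E R n r h)^`M(i)
  = disc R n r * (d`! * 'C(n - (h - d), d))%:R * (if (d <= h)%N then E R n r (h - d) else 0).
Proof.
move=> d0 hn; pose e (J : {set 'I_n}) : {mpoly C[n]} := \prod_(j in J) 'X_j ^+ r.
transitivity (\sum_(I : {set 'I_n} | #|I| == d) d`!%:R *
    \sum_(i in I) cof I i * (E R n r h)^`M(i)).
  under eq_bigr do rewrite /field_coef -mulrA mulr_suml mulr_sumr.
  rewrite (exchange_big_dep (fun I : {set 'I_n} => #|I| == d)) /=; last by move=> i I _ /andP[].
  apply: eq_bigr => I dI; rewrite mulr_sumr; apply: eq_bigl => i.
  by rewrite dI andbT.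
transitivity (\sum_(I : {set 'I_n} | #|I| == d) d`!%:R * (disc R n r *
   \sum_(J : {set 'I_n} | (J \subset ~: I) && (#|J| + #|I| == h)%N) e J)).
  apply: eq_bigr => I /eqP dI; congr (_ * _).
  have I0 : I != set0 by rewrite -card_gt0 dI.
  have cD k : k \in I -> cof I k * (r%:R * 'X_k ^+ (r - 1))
      * \prod_(j in I | j != k) (y j - y k) = disc R n r.
    by move=> kI; rewrite (cofE kI) -mulrA.
  rewrite -(lagrange_coef Xpow_inj I0 cD) ?card_ord //.
  apply: eq_bigr => i _; rewrite mderiv_E.
  exact: mulrA.
rewrite -[LHS]mulr_sumr -[X in _ * X]mulr_sumr.
rewrite natrM -[RHS]mulrA [RHS]mulrCA -[RHS]mulrA; congr (_ * _).
rewrite mulrCA; congr (_ * _).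
rewrite (exchange_big_dep (fun J : {set 'I_n} => (#|J| + d == h)%N)) /=; last first.
  by move=> I J /eqP <- /andP[].
case: leqP => [dh|hd]; last first.
  by rewrite mulr0 big1 // => J /eqP Jh; move: hd; rewrite -Jh => hd; lia.
rewrite E_expand mulr_sumr; apply: eq_big => [J|J /eqP Jh].
  by rewrite -[RHS](eqn_add2r d) subnK.
transitivity (\sum_(I : {set 'I_n} | (I \subset ~: J) && (#|I| == d)) e J).
  apply: eq_bigl => I; rewrite subsetC; case: eqP => [->|_]; last by rewrite andbF.
  by rewrite Jh eqxx !andbT.
rewrite sumr_const -[e J]mul1r -mulrnAl; congr (_%:R * _).
have <- : #|~: J| = (n - (h - d))%N.
  rewrite -Jh addnK; have := cardsC J; rewrite card_ord.
  by move: #|J| #|~: J| => a b; lia.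
by rewrite -cards_draws; apply: eq_card => I; rewrite !inE.
Qed.

(** The normalization absorbs the factor of [field_coef_E], which equals [(n - h + d)! / (n - h)!]
    when [d <= h]. *)
Lemma field_coef_Etilde d h : (0 < d)%N -> (0 < h <= n)%N ->
  \sum_i field_coef d i * (Etilde R n r h)^`M(i)
  = disc R n r * (if (d <= h)%N then Etilde R n r (h - d) else 0).
Proof.
move=> d0 hn; rewrite /Etilde.
under eq_bigr do rewrite mderivZ -scalerAr.
rewrite -scaler_sumr field_coef_E //; case: leqP => dh; last by rewrite !mulr0 scaler0.
have sn k (p : {mpoly C[n]}) : p *+ k = (k%:R : C) *: p by rewrite scaler_nat.
rewrite mulrAC mulr_natr sn scalerA -[RHS]scalerAr; congr (_ *: _).
rewrite mulrAC -natrM; congr (_%:R / _).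
have dN : (d <= n - (h - d))%N by lia.
have <- : (n - (h - d) - d = n - h)%N by lia.
rewrite -(bin_fact dN); lia.
Qed.

End Invariants.

(** Composition is an instance of [oeval] with values [tnth t], so [delta_oeval] applies to the
    derivation [mderiv i]. *)
Lemma mderiv_comp (F : comNzRingType) (k n : nat) (t : k.-tuple {mpoly F[n]}) p i :
  (p \mPo t)^`M(i) = \sum_j (p^`M(j) \mPo t) * (tnth t j)^`M(i).
Proof.
apply: (@delta_oeval F {mpoly F[n]} (@mpolyC n F) k (tnth t) (mderiv i)
  (fun j => (tnth t j)^`M(i))) => //.
- exact: mderivB.
- exact: mderivM.
- exact: mderivC.
- by move=> j x; rewrite mulrC.
Qed.

(** * The coefficients of a formal logarithm *)

Section FormalLogarithm.
Variables (F : numFieldType) (k : nat).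
Implicit Types (m : 'X_{1..k}).

(** The coefficient of [t^k] in [log (1 + u)], for [k > 0], where [u] is the sum of the
    [X_h t^(h+1)]. *)
Definition ulog : {mpoly F[k]} :=
  \sum_(m : {ffun 'I_k -> 'I_k.+1} | is_part m)
    ((-1) ^+ (part_length m - 1) * (part_length m - 1)`!%:R
       / (\prod_(h < k) (m h)`!)%N%:R : F)
    *: \prod_(h < k) 'X_h ^+ m h.

Let mfact m := (\prod_(h < k) (m h)`!)%N.

Let log_coef m : F := (-1) ^+ (mdeg m - 1) * (mdeg m - 1)`!%:R / (mfact m)%:R.

(** The coefficient of the monomial [m] in [1 / (1 + u)]. *)
Let geom_coef m : F := (-1) ^+ mdeg m * (mdeg m)`!%:R / (mfact m)%:R.

Let mfact_neq0 m : (mfact m)%:R != 0 :> F.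
Proof. by rewrite pnatr_eq0 -lt0n prodn_gt0 // => h; rewrite fact_gt0. Qed.

Let mfactD m (h : 'I_k) : mfact (m + U_(h))%MM = ((m h).+1 * mfact m)%N.
Proof.
rewrite /mfact (bigD1 h) // [in RHS](bigD1 h) //= mnmDE mnm1E eqxx addn1 factS mulnA.
congr (_ * _)%N; apply: eq_bigr => j jh.
by rewrite mnmDE mnm1E eq_sym (negbTE jh) addn0.
Qed.

Lemma coef_ulog m : ulog@_m = if mnmwgt m == k then log_coef m else 0.
Proof.
pose mon (f : {ffun 'I_k -> 'I_k.+1}) : 'X_{1..k} := [multinom (f h : nat) | h < k].
have wf f : (mnmwgt (mon f) == k) = is_part f.
  by rewrite /mnmwgt /is_part; congr (_ == _); apply: eq_bigr => h _; rewrite mnmE mulnC.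
have -> : ulog = \sum_(f : {ffun 'I_k -> 'I_k.+1} | is_part f) log_coef (mon f) *: 'X_[mon f].
  apply: eq_bigr => f _; rewrite mpolyXE_id /log_coef mdegE /part_length /mfact.
  have e h : mon f h = f h by rewrite mnmE.
  have -> : (\sum_(h < k) mon f h = \sum_(h < k) f h)%N by apply: eq_bigr => h _; rewrite e.
  have -> : (\prod_(h < k) (mon f h)`! = \prod_(h < k) (f h)`!)%N.
    by apply: eq_bigr => h _; rewrite e.
  by congr (_ *: _); apply: eq_bigr => h _; rewrite e.
rewrite raddf_sum /=; case: ifP => wm; last first.
  rewrite big1 // => f pf; rewrite mcoeffZ mcoeffX; case: eqP => [e|_]; last by rewrite mulr0.
  by rewrite -wf e wm in pf.
(* An exponent is at most the weight [k], so [m] comes from one of the finite functions indexing the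
   sum. *)
have mk h : (m h < k.+1)%N.
  by rewrite ltnS -{2}(eqP wm) /mnmwgt (bigD1 h) //= mulnS -addnA leq_addr.
pose f0 : {ffun 'I_k -> 'I_k.+1} := [ffun h => Ordinal (mk h)].
have f0E : mon f0 = m by apply/mnmP => h; rewrite mnmE ffunE.
rewrite (bigD1 f0) /= -?wf ?f0E // big1 ?addr0 => [|f /andP[_ ff0]].
  by rewrite mcoeffZ mcoeffX eqxx mulr1.
rewrite mcoeffZ mcoeffX; case: eqP => [e|_]; last by rewrite mulr0.
case/eqP: ff0; apply/ffunP => h; apply: val_inj; rewrite ffunE /= -e mnmE //.
Qed.

(** The derivative of [log (1 + u)] with respect to [X_h] is [t^(h+1) / (1 + u)]. *)
Lemma coef_mderiv_ulog m h :
  (ulog^`M(h))@_m = if (mnmwgt m + h.+1 == k)%N then geom_coef m else 0.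
Proof.
rewrite mcoeff_deriv coef_ulog mnmwgtD mnmwgt1; case: eqP => _; last by rewrite mul0rn.
rewrite /log_coef /geom_coef mdegD mdeg1 addn1 subn1 /= mfactD.
rewrite -[LHS]mulr_natr natrM; move: (mfact_neq0 m); move: (mfact m)%:R => x x0.
have s0 : (m h).+1%:R != 0 :> F by rewrite pnatr_eq0.
move: (m h).+1%:R s0 => y y0.
by field; rewrite x0 y0.
Qed.

(** The coefficient of [t^j] in [1 + u], with [X_g] in degree [g + 1]. *)
Definition uvar (j : nat) : {mpoly F[k]} :=
  if j is g.+1 then oapp (fun g : 'I_k => 'X_g : {mpoly F[k]}) 0 (insub g) else 1.

Lemma coef_mpolyXl (g : 'I_k) (p : {mpoly F[k]}) m :
  ('X_g * p)@_m = if (0 < m g)%N then p@_(m - U_(g))%MM else 0.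
Proof.
case: ltnP => [g0|mg].
  have e : m = (U_(g) + (m - U_(g)))%MM.
    by rewrite addmC submK //; apply/mnm_lepP => i; rewrite mnm1E; case: eqP => // <-.
  by rewrite {1}e mulrC mcoeffMX.
elim/mpoly_linear_ind: p => [m'|p q p0 q0|c p p0].
- rewrite -mpolyXD mcoeffX; case: eqP => // e; move: mg.
  by rewrite -e mnmDE mnm1E eqxx.
- by rewrite mulrDr mcoeffD p0 q0 addr0.
- by rewrite -scalerAr mcoeffZ p0 mulr0.
Qed.

Let coef_term m (h : 'I_k) d (hd : (d <= h)%N) (gk : (h - d < k)%N) : (0 < d)%N ->
  (uvar (h.+1 - d) * ulog^`M(h))@_m
  = if (mnmwgt m + d == k)%N then log_coef m * (m (Ordinal gk))%:R else 0.
Proof.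
move=> d0; rewrite subSn //= insubT /= coef_mpolyXl; set g := Ordinal gk.
case: ltnP => [mg|]; last first.
  by rewrite leqn0 => /eqP ->; rewrite mulr0 if_same.
have e : m = ((m - U_(g)) + U_(g))%MM.
  by rewrite submK //; apply/mnm_lepP => i; rewrite mnm1E; case: eqP => // <-.
rewrite coef_mderiv_ulog; set m' := (m - U_(g))%MM in e *.
rewrite {1}e mnmwgtD mnmwgt1 -addnA /=.
have -> : ((h - d).+1 + d = h.+1)%N by lia.
case: eqP => // _; rewrite /geom_coef /log_coef e mdegD mdeg1 addn1 subn1 /=.
rewrite mfactD mnmDE mnm1E eqxx addn1 natrM; move: (mfact_neq0 m').
have s0 : (m' g).+1%:R != 0 :> F by rewrite pnatr_eq0.
move: (mfact m')%:R s0 => x; move: (m' g).+1%:R => y y0 x0.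
by field; rewrite x0 y0.
Qed.

(* The coefficients of the partial derivatives of the logarithm are those of
   the inverse series, hence this convolution identity. *)
Lemma ulog_deriv_conv d : (0 < d <= k)%N ->
  \sum_(h < k | (d <= h.+1)%N) uvar (h.+1 - d) * ulog^`M(h) = (d == k)%:R.
Proof.
move=> /andP[d0 dk]; apply/mpolyP => m; rewrite raddf_sum /=.
have d1k : (d.-1 < k)%N by lia.
pose hd := Ordinal d1k.
(* The term [h = d - 1] has the constant factor [uvar 0 = 1] and is treated apart from those with a
   variable. *)
rewrite (bigD1 hd) /=; last by rewrite prednK.
rewrite prednK // subnn mul1r coef_mderiv_ulog /= prednK //.
pose mm g := oapp (fun g : 'I_k => m g) 0%N (insub g).
have mmE (g : 'I_k) : mm g = m g by rewrite /mm valK.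
transitivity (if (mnmwgt m + d == k)%N
    then geom_coef m + log_coef m * (\sum_(h < k | (d <= h)%N) mm (h - d)%N)%:R else 0).
  rewrite (eq_bigl (fun h : 'I_k => (d <= h)%N)) => [|h]; last first.
    by rewrite -val_eqE /=; lia.
  rewrite (eq_bigr (fun h : 'I_k => if (mnmwgt m + d == k)%N
      then log_coef m * (mm (h - d)%N)%:R else 0)) => [|h dh]; last first.
    have gk : (h - d < k)%N by rewrite (leq_ltn_trans (leq_subr _ _)).
    by rewrite (coef_term m dh gk) // -(mmE (Ordinal gk)).
  case: eqP => _; last by rewrite add0r big1.
  by rewrite -mulr_sumr natr_sum.
have -> : (d == k)%:R@_m = (if (mnmwgt m + d == k)%N then (m == 0%MM)%:R else 0) :> F.
  case: (d =P k) => [->|dk']; last first.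
    rewrite mcoeff0; case: eqP => // wm; case: eqP => // m0; case: dk'.
    by rewrite -wm m0 mnmwgt0.
  rewrite mcoeff1 -[X in (_ == X :> nat)]add0n (eqn_add2r k _ 0%N).
  by case: (m =P 0%MM) => [->|_]; rewrite ?mnmwgt0 ?if_same.
case: eqP => // wm.
(* The sum misses only the exponents of index at least [k - d]; these vanish because [m] has weight
   [k - d]. *)
have -> : (\sum_(h < k | d <= h) mm (h - d) = mdeg m)%N.
  rewrite mdegE -(eq_bigr _ (fun g _ => mmE g)) -(big_mkord xpredT mm).
  rewrite (@big_cat_nat _ _ _ (k - d)) ?leq_subr //=.
  rewrite [X in (_ = _ + X)%N]big_nat_cond [X in (_ = _ + X)%N]big1 => [|g]; last first.
    rewrite andbT /mm => /andP[kg gk]; rewrite insubT /=.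
    have := leq_addr (\sum_(i < k | i != Ordinal gk) m i * i.+1)%N (m (Ordinal gk) * g.+1)%N.
    have -> : (m (Ordinal gk) * g.+1 + \sum_(i < k | i != Ordinal gk) m i * i.+1)%N = mnmwgt m.
      by rewrite /mnmwgt [RHS](bigD1 (Ordinal gk)).
    case: (m (Ordinal gk)) => // a; rewrite mulSn => ag; lia.
  rewrite addn0 -[LHS](big_geq_mkord d k xpredT (fun h => mm (h - d)%N)) -{1}[d]add0n big_addn.
  by apply: eq_bigr => i _; rewrite addnK.
case: (m =P 0%MM) => [->|/eqP m0].
  rewrite /geom_coef mdeg0 mulr0 addr0 /mfact big1 ?divr1 ?mulr1 // => i _.
  by rewrite mnm0E.
rewrite /geom_coef /log_coef; case: (mdeg m) (mdeg_eq0 m) => [|l] e.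
  by rewrite -e eqxx in m0.
(* With [l + 1] the degree of [m], the two terms cancel because [(l + 1)! = (l + 1) * l!] and the
   signs are opposite. *)
rewrite subn1 /= factS exprS natrM; ring.
Qed.

End FormalLogarithm.

(** * Polynomial vector fields and their brackets *)

Section VectorFields.
Variables (F : comNzRingType) (n : nat).
Implicit Types (b : 'I_n -> {mpoly F[n]}) (f g u : {mpoly F[n]}).

Definition dir b f := \sum_i b i * f^`M(i).

Lemma dirM b f g : dir b (f * g) = dir b f * g + f * dir b g.
Proof.
rewrite /dir mulr_suml mulr_sumr -big_split; apply: eq_bigr => i _ /=.
by rewrite mderivM; ring.
Qed.

Lemma dir_sum b (I : finType) (f : I -> {mpoly F[n]}) :
  dir b (\sum_i f i) = \sum_i dir b (f i).
Proof.
rewrite /dir exchange_big; apply: eq_bigr => i _ /=.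
by rewrite raddf_sum mulr_sumr.
Qed.

Lemma dirMn b f k : dir b (f *+ k) = dir b f *+ k.
Proof. by rewrite /dir -sumrMnl; apply: eq_bigr => i _; rewrite mderivMn mulrnAr. Qed.

Lemma dir_bracket b b' u :
  \sum_j (dir b (b' j) - dir b' (b j)) * u^`M(j) = dir b (dir b' u) - dir b' (dir b u).
Proof.
rewrite [X in dir b X]/dir [X in dir b' X]/dir !dir_sum -sumrB.
(* The second-order terms agree by symmetry of mixed partial derivatives, so only first-order terms
   remain in the bracket. *)
have sym : \sum_j b' j * dir b u^`M(j) = \sum_j b j * dir b' u^`M(j).
  rewrite /dir; under eq_bigr do rewrite mulr_sumr.
  rewrite exchange_big; apply: eq_bigr => i _ /=; rewrite mulr_sumr; apply: eq_bigr => j _.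
  by rewrite mulrCA mderiv_comm.
transitivity (\sum_j ((dir b (b' j) - dir b' (b j)) * u^`M(j)
    + (b' j * dir b u^`M(j) - b j * dir b' u^`M(j)))).
  by rewrite big_split /= sumrB sym subrr addr0.
apply: eq_bigr => j _ /=; rewrite !dirM; ring.
Qed.

(* The vector field on the left is D^3 times the commutator of the fields
   D^-1 * dir b and D^-1 * dir b', which both map u to a constant. *)
Lemma dir_scaled_bracket b b' D u x x' : dir b u = D *+ x -> dir b' u = D *+ x' ->
  dir (fun j => D * (dir b (b' j) - dir b' (b j)) - dir b D * b' j + dir b' D * b j) u = 0.
Proof.
move=> bu b'u.
transitivity (D * (\sum_j (dir b (b' j) - dir b' (b j)) * u^`M(j))
    - dir b D * dir b' u + dir b' D * dir b u).
  have dE c : dir c u = \sum_j c j * u^`M(j) by [].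
  rewrite !dE !mulr_sumr -sumrB -big_split.
  by apply: eq_bigr => j _ /=; ring.
rewrite dir_bracket bu b'u !dirMn; ring.
Qed.

End VectorFields.

(** * The fields on the [U k], and the vanishing of their brackets *)

Section Flat.
Variables (R : realType) (n r : nat).
Hypothesis hr : (1 <= r)%N.
Local Notation C := R[i].
Variable cof : {set 'I_n} -> 'I_n -> {mpoly C[n]}.
Hypothesis cofE : forall (I : {set 'I_n}) i, i \in I ->
  disc R n r = cof I i * denominator R r I i.

Lemma U_comp k :
  U R n r k = ulog C k \mPo [tuple Etilde R n r h.+1 | h < k].
Proof.
rewrite /U /ulog raddf_sum; apply: eq_bigr => m _ /=.
rewrite comp_mpolyZ [in RHS](rmorph_prod (comp_mpoly _)); congr (_ *: _).
apply: eq_bigr => h _.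
by rewrite [RHS](rmorphXn (comp_mpoly _)) /= comp_mpolyXU -tnth_nth tnth_mktuple.
Qed.

Lemma Etilde0 : Etilde R n r 0 = 1.
Proof.
rewrite /Etilde /E subn0 mesym0E comp_mpoly1 divff ?scale1r //.
by rewrite pnatr_eq0 -lt0n fact_gt0.
Qed.

Lemma uvar_comp k j : (j <= k)%N ->
  uvar C k j \mPo [tuple Etilde R n r h.+1 | h < k] = Etilde R n r j.
Proof.
case: j => [|j] jk; first by rewrite [LHS]comp_mpoly1 Etilde0.
by rewrite /= insubT /= comp_mpolyXU -tnth_nth tnth_mktuple.
Qed.

(** By the chain rule through [U_comp] and the shift [field_coef_Etilde], this is [ulog_deriv_conv]
    evaluated at the [Etilde], times the discriminant. For [d > k] the sum is empty. *)
Lemma dir_field_coef_U d k : (0 < d <= n)%N -> (0 < k <= n)%N ->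
  dir (field_coef cof d) (U R n r k) = disc R n r * (d == k)%:R.
Proof.
move=> /andP[d0 dn] /andP[k0 kn]; rewrite /dir U_comp.
set t := [tuple Etilde R n r h.+1 | h < k].
transitivity (\sum_(h < k) ((ulog C k)^`M(h) \mPo t) *
    (disc R n r * (if (d <= h.+1)%N then Etilde R n r (h.+1 - d) else 0))).
  under eq_bigr do rewrite mderiv_comp mulr_sumr.
  rewrite exchange_big; apply: eq_bigr => h _ /=.
  rewrite -(@field_coef_Etilde _ _ _ hr _ cofE) //; last first.
    by rewrite /= (leq_trans (ltn_ord h)).
  by rewrite mulr_sumr; apply: eq_bigr => i _; rewrite mulrCA tnth_mktuple.
transitivity (disc R n r *
    ((\sum_(h < k | (d <= h.+1)%N) uvar C k (h.+1 - d) * (ulog C k)^`M(h)) \mPo t)).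
  rewrite raddf_sum mulr_sumr [RHS]big_mkcond; apply: eq_bigr => h _ /=.
  rewrite mulrCA; case: ifP => dh; last by rewrite mulr0 mulr0.
  rewrite [in RHS](rmorphM (comp_mpoly _)) /= uvar_comp; last first.
    by rewrite (leq_trans (leq_subr _ _)).
  by rewrite [X in _ * X]mulrC.
congr (_ * _); case: (leqP d k) => dk.
  by rewrite ulog_deriv_conv ?d0 // [LHS](rmorph_nat (comp_mpoly _)).
rewrite big1 ?comp_mpoly0 => [|h dh]; first by rewrite gtn_eqF.
by have := ltn_ord h; lia.
Qed.

(** The product of the field matrix [B] and the Jacobian [J] is a nonzero scalar matrix, so [\det J]
    is nonzero; multiplying [a J = 0] by the adjugate avoids fractions. *)
Lemma killU_eq0 (a : 'I_n -> {mpoly C[n]}) :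
  (forall k, (0 < k <= n)%N -> dir a (U R n r k) = 0) -> forall i, a i = 0.
Proof.
move=> aU; pose J : 'M_n := \matrix_(i, k) (U R n r k.+1)^`M(i).
pose B : 'M_n := \matrix_(d, i) field_coef cof d.+1 i.
have BJ : B *m J = (disc R n r)%:M.
  apply/matrixP => d k; rewrite !mxE -mulr_natr -[RHS](@dir_field_coef_U d.+1 k.+1) //=.
  by apply: eq_bigr => i _; rewrite !mxE.
have J0 : \det J != 0.
  apply/eqP => J0; have := congr1 determinant BJ.
  rewrite det_mulmx J0 mulr0 det_scalar => /esym/eqP.
  by rewrite expf_eq0 (negbTE (disc_neq0 R n hr)) andbF.
have aJ : (\row_i a i) *m J = 0.
  apply/rowP => k; have kn : (0 < k.+1 <= n)%N by rewrite /= ltn_ord.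
  rewrite !mxE -[RHS](aU k.+1 kn).
  by apply: eq_bigr => i _; rewrite !mxE.
have := mulmxA (\row_i a i) J (\adj J).
rewrite aJ mul0mx mul_mx_adj mul_mx_scalar => /rowP detJa i.
by have := detJa i; rewrite !mxE => /eqP; rewrite mulf_eq0 (negbTE J0) => /eqP.
Qed.

Lemma field_coef_bracket d e j : (0 < d <= n)%N -> (0 < e <= n)%N ->
  let b := field_coef cof d in let b' := field_coef cof e in let D := disc R n r in
  D * (dir b (b' j) - dir b' (b j)) - dir b D * b' j + dir b' D * b j = 0.
Proof.
move=> dn en b b' D; move: j; apply: killU_eq0 => k kn.
apply: (@dir_scaled_bracket _ _ _ _ _ _ (d == k) (e == k)).
  by rewrite dir_field_coef_U // mulr_natr.
by rewrite dir_field_coef_U // mulr_natr.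
Qed.

End Flat.

(** * The operators D_d *)

Section ScaledFields.
Variables (F : comNzRingType) (A : pzRingType) (n : nat).
Variables (M : {rmorphism {mpoly F[n]} -> A}) (p : 'I_n -> A) (s : A) (D : {mpoly F[n]}).
Hypothesis pM : forall i f, p i * M f - M f * p i = M f^`M(i).
Hypothesis pC : forall i j, p i * p j = p j * p i.
Hypothesis sl : s * M D = 1.
Hypothesis sr : M D * s = 1.
Implicit Types (b : 'I_n -> {mpoly F[n]}) (f : {mpoly F[n]}).

Lemma multC f g : M f * M g = M g * M f.
Proof. by rewrite -!rmorphM mulrC. Qed.

Lemma inv_multC f : s * M f = M f * s.
Proof.
rewrite -[LHS]mulr1 -sr [_ * (_ * s)]mulrA -[s * M f * M D]mulrA multC.
by rewrite [s * (_ * _)]mulrA sl mul1r.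
Qed.

Definition field b : A := \sum_i M (b i) * p i.

Lemma fieldM b f : field b * M f = M f * field b + M (dir b f).
Proof.
rewrite /dir rmorph_sum mulr_suml mulr_sumr -big_split; apply: eq_bigr => i _ /=.
by rewrite rmorphM -pM -mulrA mulrBr !mulrA [M f * M _]multC addrC subrK.
Qed.

(** The derivative of an inverse, with [s] in the role of [D^-1]. *)
Lemma field_inv b : field b * s = s * field b - s * s * M (dir b D).
Proof.
rewrite -mulrA inv_multC mulrA.
have e := fieldM b D; apply/eqP; rewrite eq_sym subr_eq -mulrDl; apply/eqP.
have -> : field b + s * M (dir b D) = s * (M D * field b + M (dir b D)).
  by rewrite mulrDr mulrA sl mul1r.
by rewrite -e -!mulrA sr mulr1.
Qed.

(** Separates the first-order part of the product from its second-order part. *)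
Lemma field_mul b b' :
  field b * field b' = field (fun j => dir b (b' j)) + \sum_i \sum_j M (b i * b' j) * (p i * p j).
Proof.
rewrite {2}/field mulr_sumr exchange_big -big_split; apply: eq_bigr => j _ /=.
rewrite mulrA fieldM mulrDl addrC; congr (_ + _).
rewrite mulr_sumr mulr_suml; apply: eq_bigr => i _.
by rewrite [b i * _]mulrC rmorphM !mulrA.
Qed.

Lemma field_comm_mult b f : s * field b * M f - M f * (s * field b) = s * M (dir b f).
Proof.
by rewrite -mulrA fieldM mulrDr !mulrA inv_multC addrAC subrr add0r.
Qed.

Lemma field_scale f b : field (fun j => f * b j) = M f * field b.
Proof. by rewrite mulr_sumr; apply: eq_bigr => i _; rewrite rmorphM mulrA. Qed.

Lemma fieldD b b' : field (fun j => b j + b' j) = field b + field b'.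
Proof. by rewrite -big_split; apply: eq_bigr => i _; rewrite rmorphD mulrDl. Qed.

Lemma fieldB b b' : field (fun j => b j - b' j) = field b - field b'.
Proof. by rewrite -sumrB; apply: eq_bigr => i _; rewrite rmorphB mulrBl. Qed.

Lemma scaled_field_mul b b' : s * field b * (s * field b')
  = s * s * s * (M D * (field b * field b') - M (dir b D) * field b').
Proof.
rewrite -[LHS]mulrA [field b * _]mulrA field_inv mulrBl !mulrBr; congr (_ - _).
  by rewrite -!mulrA [s * (M D * _)]mulrA sl mul1r.
by rewrite !mulrA.
Qed.

(** After the common factor [s * s * s] is removed, the second-order parts cancel because the [p i]
    commute; the first-order parts form the field assumed to vanish. *)
Lemma scaled_fieldC b b' :
  (forall j, D * (dir b (b' j) - dir b' (b j)) - dir b D * b' j + dir b' D * b j = 0) ->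
  s * field b * (s * field b') = s * field b' * (s * field b).
Proof.
move=> bb'; rewrite !scaled_field_mul; congr (_ * _); apply/subr0_eq.
have sym : \sum_i \sum_j M (b i * b' j) * (p i * p j) = \sum_i \sum_j M (b' i * b j) * (p i * p j).
  rewrite exchange_big; apply: eq_bigr => i _; apply: eq_bigr => j _.
  by rewrite mulrC pC.
transitivity (field (fun j => D * (dir b (b' j) - dir b' (b j)) - dir b D * b' j + dir b' D * b j)).
  rewrite [field b * field b']field_mul [field b' * field b]field_mul sym.
  move: (\sum_i _) => S; rewrite fieldD fieldB !field_scale fieldB.
  move: (field (fun j => dir b (b' j))) (field (fun j => dir b' (b j))) => X Y.
  rewrite !mulrDr mulrN !opprB.
  (* Only an identity in an abelian group is left. *)
  move: (M D * X) (M D * Y) (M D * S) (M _ * field b') (M _ * field b) => x y z u v.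
  apply: (addIr (y + z)); rewrite -addrA subrK [RHS]addrC -!addrA.
  rewrite [z + (x + _)]addrCA [z + (- y + _)]addrCA [x + (- y + _)]addrCA.
  by rewrite [RHS]addrA subrr add0r.
rewrite /field big1 // => j _; by rewrite bb' rmorph0 mul0r.
Qed.

(** For [D = g f1 f2] the inverses of [f1] and [f2] are [g f2 / D] and [g f1 / D], with product
    [g / D]. This merges the two successive inverses in [D_set]. *)
Lemma cofactor_inv_mul f1 f2 g (x : A) : D = g * (f2 * f1) ->
  M (g * f2) * s * (M (g * f1) * s * x) = s * (M g * x).
Proof.
move=> De; rewrite !mulrA -inv_multC -[s * _ * _]mulrA -rmorphM.
have -> : g * f2 * (g * f1) = g * D by rewrite De; ring.
by rewrite rmorphM -!mulrA [M D * _]mulrA sr mul1r.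
Qed.

Lemma sum_scaled_fields (cof : {set 'I_n} -> 'I_n -> {mpoly F[n]}) (S : pred {set 'I_n}) k :
  (\sum_(I : {set 'I_n} | S I) s * \sum_(i in I) M (cof I i) * p i) *+ k
  = s * field (fun i => k%:R * \sum_(I : {set 'I_n} | (i \in I) && S I) cof I i).
Proof.
rewrite -mulr_sumr field_scale rmorph_nat -mulrnAr mulr_natl; congr (_ * (_ *+ _)).
rewrite (exchange_big_dep xpredT) //=; apply: eq_bigr => i _.
by rewrite rmorph_sum mulr_suml; apply: eq_bigl => I; rewrite andbC.
Qed.

End ScaledFields.

Section PresentedInverse.
Variables (F : comNzRingType) (I : choiceType) (rels : set (free_alg F I)).

Lemma presented_invE (x y : presented rels) : x * y = 1 -> y * x = 1 -> presented_inv x = y.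
Proof.
move=> xy yx; rewrite /presented_inv; apply: xget_unique => [//|z [xz zx]].
by rewrite -[z]mul1r -yx -mulrA xz mulr1.
Qed.

End PresentedInverse.

(** * The operators in the Weyl algebra localized at the discriminant *)

Section DiscriminantLocalization.
Variables (R : realType) (n r : nat).
Local Notation C := R[i].
Local Notation A := (weyl_disc R n r).
Local Notation M := (mult r).
Local Notation dsc := (disc R n r).

Lemma mult_zmod : zmod_morphism (M : {mpoly C[n]} -> A).
Proof.
move=> f g; transitivity (loc_map (weyl_poly dsc) (weyl_poly f - weyl_poly g)).
  congr (loc_map _ _); exact: weyl_poly_zmod.
exact: loc_map_zmod.
Qed.

Lemma mult_monoid : monoid_morphism (M : {mpoly C[n]} -> A).
Proof.
split=> [|f g].
  transitivity (loc_map (weyl_poly dsc) 1); last exact: (loc_map_monoid _).1.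
  congr (loc_map _ _); exact: (weyl_poly_monoid _ _).1.
transitivity (loc_map (weyl_poly dsc) (weyl_poly f * weyl_poly g)).
  congr (loc_map _ _); exact: (weyl_poly_monoid _ _).2.
exact: (loc_map_monoid _).2.
Qed.

HB.instance Definition _ :=
  GRing.isZmodMorphism.Build {mpoly C[n]} A (@mult R n r) mult_zmod.
HB.instance Definition _ :=
  GRing.isMonoidMorphism.Build {mpoly C[n]} A (@mult R n r) mult_monoid.

Let p (i : 'I_n) : A := partial R r i.
Let s : A := loc_inv (weyl_poly dsc).

Let pM i f : p i * M f - M f * p i = M f^`M(i).
Proof.
transitivity (loc_map (weyl_poly dsc) (weyl_p C i * weyl_poly f - weyl_poly f * weyl_p C i)).
  rewrite (loc_map_zmod _ (_ * _)); congr (_ - _); apply/esym; exact: (loc_map_monoid _).2.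
congr (loc_map _ _); exact: weyl_p_poly.
Qed.

Let pC i j : p i * p j = p j * p i.
Proof.
transitivity (loc_map (weyl_poly dsc) (weyl_p C i * weyl_p C j)).
  apply/esym; exact: (loc_map_monoid _).2.
rewrite weyl_pC; exact: (loc_map_monoid _).2.
Qed.

Let sl : s * M dsc = 1. Proof. exact: loc_invl. Qed.
Let sr : M dsc * s = 1. Proof. exact: loc_invr. Qed.

Lemma mult_inv (f g : {mpoly C[n]}) : dsc = g * f -> presented_inv (M f) = M g * s.
Proof.
move=> fg; apply: presented_invE.
  by rewrite mulrA -(rmorphM (@mult R n r)) mulrC -fg.
by rewrite -mulrA (inv_multC sl sr) mulrA -(rmorphM (@mult R n r)) -fg.
Qed.

Hypothesis hr : (1 <= r)%N.
Variable cof : {set 'I_n} -> 'I_n -> {mpoly C[n]}.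
Hypothesis cofE : forall (I : {set 'I_n}) i, i \in I ->
  dsc = cof I i * denominator R r I i.

Let inv_mul2 f1 f2 g (x : A) : dsc = g * (f2 * f1) ->
  presented_inv (M f1) * (presented_inv (M f2) * x) = s * (M g * x).
Proof.
move=> De; transitivity (M (g * f2) * s * (M (g * f1) * s * x)); last first.
  exact: (cofactor_inv_mul sl sr).
have e1 : presented_inv (M f1) = M (g * f2) * s by apply: mult_inv; rewrite De mulrA.
have e2 : presented_inv (M f2) = M (g * f1) * s.
  by apply: mult_inv; rewrite De mulrAC mulrA.
exact: (congr2 (fun u v : A => u * (v * x)) e1 e2).
Qed.

Lemma D_setE (I : {set 'I_n}) : D_set R r I = s * \sum_(i in I) M (cof I i) * p i.
Proof.
rewrite mulr_sumr; apply: eq_bigr => i iI.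
apply: inv_mul2; exact: cofE.
Qed.

Lemma D_field d : D R n r d = s * field (@mult R n r) p (field_coef cof d).
Proof.
transitivity ((\sum_(I : {set 'I_n} | #|I| == d) D_set R r I) *+ d`!).
  exact: scaler_nat.
under eq_bigr do rewrite D_setE.
exact: sum_scaled_fields.
Qed.

Lemma mult_UC k l : M (U R n r k) * M (U R n r l) = M (U R n r l) * M (U R n r k).
Proof. exact: multC. Qed.

Lemma D_comm d e : (0 < d <= n)%N -> (0 < e <= n)%N ->
  D R n r d * D R n r e = D R n r e * D R n r d.
Proof.
move=> dn en; rewrite !D_field; apply: (scaled_fieldC pM pC sl sr) => j.
exact: field_coef_bracket.
Qed.

Lemma D_mult_U d k : (0 < d <= n)%N -> (0 < k <= n)%N ->
  D R n r d * M (U R n r k) - M (U R n r k) * D R n r d = (d == k)%:R.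
Proof.
move=> dn kn; rewrite D_field; transitivity (s * M (dir (field_coef cof d) (U R n r k))).
  exact: (field_comm_mult pM sl sr).
rewrite (dir_field_coef_U hr cofE dn kn).
transitivity (s * (M dsc * M (d == k)%:R)); first by congr (_ * _); exact: rmorphM.
rewrite mulrA sl mul1r; exact: rmorph_nat.
Qed.

Lemma D_weyl_isom : isom_subalg (subalg_gen (@Weyl_gens R n r)) (@weyl_rels C n).
Proof.
pose rels := loc_rels (weyl_poly dsc).
have ord_bound (i : 'I_n) : (0 < i.+1 <= n)%N by rewrite /= ltn_ord.
have [|||||f [fp fq fZ]] := @weyl_lift C n A (pscal rels) (fun i => D R n r i.+1)
  (fun i => M (U R n r i.+1)).
- by move=> k i; apply: pscalC.
- by move=> k i; apply: pscalC.
- by move=> d k; apply: D_mult_U.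
- by move=> d k; apply: D_comm.
- by move=> d k; apply: mult_UC.
have disc0 : dsc != 0 by apply: disc_neq0.
exists f; split.
- by move=> k x; rewrite fZ [RHS]pscalE.
- apply: (weyl_morphism_inj fZ); exact: weyl_localization_nontrivial.
apply/seteqP; split=> x.
  (* The image lies in every subalgebra containing the generators, by induction on [z]. *)
  case=> z _ <- S [S1 SM] [S0 SZ] SG.
  elim/presented_ind: z => [|y z Sy Sz|k y Sy|i y Sy].
  - by rewrite rmorph1.
  - by rewrite rmorphD -[f y]scale1r SZ.
  - by rewrite fZ -pscalE -[_ *: _]addr0 SZ.
  - rewrite (rmorphM f); apply: (SM) => //; apply: SG; case: i => i.
      by exists i.+1 => //; right; apply: fp.
    by exists i.+1 => //; left; apply: fq.
(* Conversely, the image is itself a subalgebra containing the generators. *)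
move=> /(_ (fun x => `[< exists z, f z = x >])) genx.
suff /asboolP[z <-] : `[< exists z, f z = x >] by exists z.
apply: genx.
- split=> [|y z /asboolP[u <-] /asboolP[v <-]]; apply/asboolP.
    by exists 1; apply: rmorph1.
  by exists (u * v); apply: rmorphM.
- split=> [|k y z /asboolP[u <-] /asboolP[v <-]]; apply/asboolP.
    by exists 0; apply: rmorph0.
  exists (k *: u + v); rewrite [RHS]/=.
  by rewrite (rmorphD f) fZ -pscalE.
- move=> y [k /andP[k0 kn] yk]; apply/asboolP.
  have kn' : (k.-1 < n)%N by rewrite prednK.
  rewrite -(prednK k0) in yk; case: yk => ->.
    by exists (weyl_q C (Ordinal kn')); apply: fq.
  by exists (weyl_p C (Ordinal kn')); apply: fp.
Qed.

End DiscriminantLocalization.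

Theorem corollary6p3 (R : realType) (n r : nat) (hn : (1 <= n)%N) (hr : (1 <= r)%N) :
  [/\ forall k l : nat, (1 <= k <= n)%N -> (1 <= l <= n)%N ->
        mult r (U R n r k) * mult r (U R n r l)
        = mult r (U R n r l) * mult r (U R n r k),
      forall d e : nat, (1 <= d <= n)%N -> (1 <= e <= n)%N ->
        D R n r d * D R n r e = D R n r e * D R n r d,
      forall d k : nat, (1 <= d <= n)%N -> (1 <= k <= n)%N ->
        D R n r d * mult r (U R n r k) - mult r (U R n r k) * D R n r d
        = (d == k)%:R,
      isom_subalg (subalg_gen (@Weyl_gens R n r)) (@weyl_rels R[i] n) &
      forall (I : {set 'I_n}) (i : 'I_n), i \in I ->
        mpoly_dvd (denominator R r I i) (disc R n r)].
Proof.
(* All cofactors are chosen at once; pairs with [i] outside [I] get the default value 0. *)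
have dvd : forall (Ii : {set 'I_n} * 'I_n), exists g : {mpoly R[i][n]}, Ii.2 \in Ii.1 ->
    disc R n r = g * denominator R r Ii.1 Ii.2.
  move=> [I i] /=; case: (boolP (i \in I)) => [/(denominator_dvd_disc R hr)[g ->]|_].
    by exists g.
  by exists 0.
have [cof cofE] := choice dvd.
have cofE' (I : {set 'I_n}) (i : 'I_n) : i \in I ->
    disc R n r = cof (I, i) * denominator R r I i by apply: (cofE (I, i)).
split.
- by move=> k l _ _; apply: mult_UC.
- exact: (D_comm hr cofE').
- exact: (D_mult_U hr cofE').
- exact: (D_weyl_isom hr cofE').
- by move=> I i; apply: denominator_dvd_disc.
Qed.
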